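(* Let $k$ be a positive integer and let $\mathcal{P}_k=\{p^k-1 : p \text{ prime}\}\subset\mathbb{N}$. Then for Lebesgue-almost all real numbers $x$, $$\lim_{n\to\infty}\frac1n\#\{1\le i\le n: a_i(x)\in\mathcal{P}_k\}=\log_2\zeta(2k),$$ where $\zeta$ is the Riemann zeta function. In particular, for $k=1$ (digits of the form $p-1$ with $p$ prime) this limit equals $\log_2\zeta(2)=\log_2\frac{\pi^2}{6}$ for almost all $x$.
   Context: Every irrational real number $x$ has a unique infinite continued fraction expansion $x=a_0+\cfrac{1}{a_1+\cfrac{1}{a_2+\cdots}}=[a_0;a_1,a_2,\dots]$ with $a_0=\lfloor x\rfloor\in\mathbb{Z}$ and $a_i=a_i(x)$ positive integers for $i\ge1$; the $a_i(x)$, $i\ge 1$, are called the continued fraction digits of $x$. $\mathbb{N}=\{1,2,3,\dots\}$ and $\log_2$ denotes the base-2 logarithm. *)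

(* Defs.v *)
From HB Require Import structures.
From mathcomp Require Import all_boot all_order all_algebra.
From mathcomp Require Import all_classical all_reals all_analysis.
From mathcomp Require Import ring lra.

Set Implicit Arguments.
Unset Strict Implicit.
Unset Printing Implicit Defensive.

Import Order.TTheory GRing.Theory Num.Theory.
Import numFieldNormedType.Exports.

Local Open Scope classical_set_scope.
Local Open Scope ring_scope.

Section ContinuedFractions.
Variable R : realType.
Implicit Types (a : nat -> int) (x : R).

(* [a 0; a 1, ..., a n] *)
Fixpoint cf_convergent a (n : nat) : R :=
  if n is m.+1 then (a 0)%:~R + (cf_convergent (fun i => a i.+1) m)^-1
  else (a 0)%:~R.

Definition is_cf_expansion a x : Prop :=
  (forall i, (0 < i)%N -> 0 < a i) /\
  cf_convergent a n @[n --> \oo] --> x.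

Definition cf_step x : R := (x - (Num.floor x)%:~R)^-1.

(* On rational x the orbit of cf_step reaches 0 (as 0^-1 = 0) and the later
   digits are the junk value 0.  On irrational x, cf_digit x is the unique
   infinite expansion of x: see cf_expansionP below. *)
Definition cf_digit x (i : nat) : int := Num.floor (iter i cf_step x).

(* #{1 <= i <= n : a_i(x) \in A} / n *)
Definition cf_digit_freq (A : set int) x (n : nat) : R :=
  (count (fun i => cf_digit x i \in A) (iota 1 n))%:R / n%:R.

Lemma rational_int (m : int) : @rational R m%:~R.
Proof. by exists m%:~R => //; rewrite ratr_int. Qed.

Lemma irrationalBz x (m : int) : irrational x -> irrational (x - m%:~R).
Proof.
move=> ix [q _ qE]; apply: ix; exists (q + m%:~R) => //.
by rewrite rmorphD/= ratr_int qE subrK.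
Qed.

Lemma irrationalV x : irrational x -> irrational x^-1.
Proof.
move=> ix [q _ qE]; apply: ix; exists q^-1 => //.
by rewrite fmorphV/= qE invrK.
Qed.

Lemma irrational_step x : irrational x -> irrational (cf_step x).
Proof. by move=> ix; apply: irrationalV; apply: irrationalBz. Qed.

Lemma irrational_fracP x : irrational x ->
  0 < x - (Num.floor x)%:~R < 1.
Proof.
move=> ix; have /andP[f1 f2] := floor_itv x.
rewrite subr_gt0 lt_neqAle f1 andbT; apply/andP; split; last first.
  by move: f2; rewrite intrD ltrBlDl.
by apply/eqP => e; apply: ix; rewrite -e; exact: rational_int.
Qed.

Lemma cf_step_gt1 x : irrational x -> 1 < cf_step x.
Proof. by move=> /irrational_fracP /andP[x0 x1]; rewrite invf_gt1. Qed.

Lemma cf_stepE x : irrational x -> x = (Num.floor x)%:~R + (cf_step x)^-1.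
Proof. by move=> ix; rewrite invrK addrC subrK. Qed.

Lemma cf_digitS x i : cf_digit x i.+1 = cf_digit (cf_step x) i.
Proof. by rewrite /cf_digit iterSr. Qed.

Lemma cf_digit_gt0 x i : irrational x -> (0 < i)%N -> 0 < cf_digit x i.
Proof.
case: i => // i ix _; elim: i x ix => [|i IH] x ix.
  by rewrite floor_gt0 ltW// cf_step_gt1.
by rewrite cf_digitS IH//; exact: irrational_step.
Qed.

Lemma cf_convergentS a n :
  cf_convergent a n.+1 =
  (a 0)%:~R + (cf_convergent (fun i => a i.+1) n)^-1.
Proof. by []. Qed.

Lemma eq_cf_convergent a b : a =1 b -> cf_convergent a =1 cf_convergent b.
Proof.
move=> ab n; elim: n a b ab => [|n IH] a b ab /=; rewrite ab//.
by rewrite (IH _ (fun i => b i.+1)).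
Qed.

Lemma cf_convergent_ge1 a n : (forall i, 0 < a i) -> 1 <= cf_convergent a n.
Proof.
have a1 (m : int) : 0 < m -> 1 <= m%:~R :> R by rewrite ler1z.
elim: n a => [|n IH] a a0 /=; first exact: a1.
rewrite -[leLHS]addr0; apply: lerD; first exact: a1.
by rewrite invr_ge0 (le_trans ler01)// IH.
Qed.

Lemma cf_convergent_digitS x n : cf_convergent (cf_digit x) n.+1 =
  (Num.floor x)%:~R + (cf_convergent (cf_digit (cf_step x)) n)^-1.
Proof.
by rewrite /=; congr (_ + _^-1); apply: eq_cf_convergent => i; rewrite cf_digitS.
Qed.

Lemma cf_convergent_digit_ge1 x n : irrational x -> 1 < x ->
  1 <= cf_convergent (cf_digit x) n.
Proof.
move=> ix x1; apply: cf_convergent_ge1 => -[|i]; last exact: cf_digit_gt0.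
by rewrite floor_gt0 ltW.
Qed.

Lemma distV (u v : R) : 0 < u -> 0 < v -> `|u^-1 - v^-1| = `|u - v| / (u * v).
Proof.
move=> u0 v0; have uv : 0 < u * v by rewrite mulr_gt0.
rewrite -[X in _ / X](gtr0_norm uv) -normfV -normrM distrC; congr (`| _ |).
by field; rewrite !gt_eqF.
Qed.

Lemma cf_convergent_dist x n : irrational x ->
  `|cf_convergent (cf_digit x) n - x| <= 2 * 2^-1 ^+ n.
Proof.
have [m] := ubnP n; elim: m n x => // m IH [|[|n]] x nm ix.
- have /andP[] := irrational_fracP ix.
  rewrite /cf_digit /= expr0 mulr1 => h0 h1; rewrite distrC gtr0_norm//; lra.
- rewrite cf_convergent_digitS {3}(cf_stepE ix) /= opprD addrACA subrr add0r.
  rewrite /cf_digit /=.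
  have := cf_step_gt1 ix; set y := cf_step x => y1.
  have iy : irrational y by exact: irrational_step.
  have /andP[h0 h1] := irrational_fracP iy.
  have f1 : 1 <= (Num.floor y)%:~R :> R by rewrite ler1z -gtz0_ge1 floor_gt0 ltW.
  rewrite distV; [|lra|lra].
  rewrite expr1 divff ?ler_pdivrMr; [|nra..].
  by rewrite mul1r distrC gtr0_norm//; nra.
- set y := cf_step x; set z := cf_step y.
  have iy : irrational y by exact: irrational_step.
  have iz : irrational z by exact: irrational_step.
  have y1 : 1 < y by exact: cf_step_gt1.
  have z1 : 1 < z by exact: cf_step_gt1.
  have := IH n z (ltnW nm) iz.
  have /(_ n) := fun n => @cf_convergent_digit_ge1 z n iz z1.
  rewrite cf_convergent_digitS {3}(cf_stepE ix) -/y opprD addrACA subrr add0r.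
  rewrite cf_convergent_digitS {3}(cf_stepE iy) -/z.
  set c := cf_convergent _ n => c1 ih.
  have f1 : 1 <= (Num.floor y)%:~R :> R by rewrite ler1z -gtz0_ge1 floor_gt0 ltW.
  set f : R := _%:~R in f1 *.
  have c'0 : 0 < c^-1 by rewrite invr_gt0; lra.
  have z'0 : 0 < z^-1 by rewrite invr_gt0; lra.
  rewrite distV ?addr_gt0//; [|lra|lra].
  rewrite opprD addrACA subrr add0r distV; [|lra|lra].
  rewrite -mulrA -invfM.
  have -> : c * z * ((f + c^-1) * (f + z^-1)) = (f * c + 1) * (f * z + 1).
    have cn0 : c != 0 by apply: lt0r_neq0; lra.
    have zn0 : z != 0 by apply: lt0r_neq0; lra.
    by field; rewrite cn0 zn0.
  have fc : 1 <= f * c by exact: mulr_ege1.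
  have fz : 1 <= f * z by apply: mulr_ege1 => //; lra.
  have : 4 <= (f * c + 1) * (f * z + 1) by nra.
  set P := (f * c + 1) * (f * z + 1) => P4.
  rewrite ler_pdivrMr; last exact: lt_le_trans P4.
  clearbody P.
  apply: (le_trans ih); rewrite !exprS.
  have : 0 < 2^-1 ^+ n :> R by rewrite exprn_gt0.
  by move: (2^-1 ^+ n) => e e0; nra.
Qed.

Lemma cf_digit_expansion x : irrational x -> is_cf_expansion (cf_digit x) x.
Proof.
move=> ix; split=> [i|]; first exact: cf_digit_gt0.
apply/cvgrPdist_le => e e0.
have : geometric 2 2^-1 n @[n --> \oo] --> (0 : R).
  by apply: cvg_geometric; rewrite ger0_norm; lra.
move/cvgrPdist_le => /(_ _ e0); apply: filterS => n.
rewrite sub0r normrN /= => h; rewrite distrC.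
by apply: le_trans (le_trans (cf_convergent_dist n ix) (ler_norm _)) h.
Qed.

Lemma cf_expansion_step a x : irrational x -> is_cf_expansion a x ->
  a 0 = Num.floor x /\ is_cf_expansion (fun i => a i.+1) (cf_step x).
Proof.
move=> ix [a0 ax].
set b := fun i => a i.+1.
have b0 i : 0 < b i by exact: a0.
have b'0 i : 0 < b i.+1 by exact: a0.
have c1 n : 1 <= cf_convergent b n by exact: cf_convergent_ge1.
have c2 n : cf_convergent b n <= (b 0)%:~R + 1.
  case: n => [|n] /=; first by rewrite lerDl.
  by rewrite lerD2l invf_le1 ?(lt_le_trans ltr01)//; exact: cf_convergent_ge1.
have cV : (cf_convergent b n)^-1 @[n --> \oo] --> x - (a 0)%:~R.
  have -> : (fun n => (cf_convergent b n)^-1) =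
      (fun n => cf_convergent a (n + 1)%N - (a 0)%:~R).
    by apply/funext => n; rewrite addn1 /= addrC addKr.
  by apply: cvgB; [rewrite cvg_shiftn | exact: cvg_cst].
have b1 : 0 < (b 0)%:~R :> R by rewrite ltr0z.
have l0 : 0 < x - (a 0)%:~R.
  apply: (@lt_le_trans _ _ ((b 0)%:~R + 1)^-1); first by rewrite invr_gt0; lra.
  rewrite -(cvg_lim _ cV)//; apply: limr_ge; first by apply/cvg_ex; eexists; exact: cV.
  by near=> n; rewrite lef_pV2 ?posrE//; [lra | apply: lt_le_trans (c1 n)].
have l1 : x - (a 0)%:~R <= 1.
  rewrite -(cvg_lim _ cV)//; apply: limr_le; first by apply/cvg_ex; eexists; exact: cV.
  by near=> n; rewrite invf_le1//; apply: lt_le_trans (c1 n).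
have a0E : a 0 = Num.floor x.
  apply/esym/floor_def; rewrite intrD.
  rewrite -subr_ge0 (ltW l0)/= -ltrBlDl lt_neqAle l1 andbT.
  apply/eqP => e; apply: (@irrationalBz x (a 0) ix); rewrite e.
  exact: (rational_int 1).
split=> //; split=> [i _|]; first exact: b0.
rewrite /cf_step -a0E.
apply: cvg_trans (cvgV (lt0r_neq0 l0) cV).
by apply: near_eq_cvg; near=> n; rewrite /= invrK.
Unshelve. all: by end_near.
Qed.

Theorem cf_expansionP a x : irrational x ->
  is_cf_expansion a x <-> a = cf_digit x.
Proof.
move=> ix; split=> [ax|->]; last exact: cf_digit_expansion.
apply/funext => i; elim: i a x ix ax => [|i IH] a x ix ax;
  have [a0E sax] := cf_expansion_step ix ax; first exact: a0E.
by rewrite cf_digitS -(IH (fun i => a i.+1))//; exact: irrational_step.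
Qed.

(* Only meaningful for 1 < s, where the series converges. *)
Definition riemann_zeta (s : R) : R :=
  limn (series (fun n => n.+1%:R `^ (- s))).

Definition log2 x : R := ln x / ln 2.

End ContinuedFractions.

Definition prime_pow_minus1 (k : nat) : set int :=
  [set p%:Z ^+ k - 1 | p in [set p : nat | prime p]].

(* Main.v *)
(* Under Lebesgue measure the digits form a chain with complete connections
   (Broden, Borel, Lévy): given the first n digits, the next one equals k + 1
   with probability (1 + s) / ((k + 1 + s) (k + 2 + s)), where
   s = q_(n-1) / q_n, and s then becomes 1 / (k + 1 + s).  The averaging
   operator of this chain contracts Lipschitz seminorms by the factor 7/8 and
   preserves the Gauss measure ds / ((1 + s) ln 2).  Hence the mean number of
   digits in A among the first n is n c + O(1) uniformly in s, where c is the
   Gauss measure of the event that the first digit lies in A, and the variance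
   is O(n); Chebyshev and Borel-Cantelli along the squares give convergence
   almost everywhere.  The digit k + 1 has Gauss measure
   - log2 (1 - 1 / (k + 2)^2), which for k + 2 = p^j is a logarithmic Euler
   factor of the zeta function at 2 j. *)

(* The state [s] keeps from the past only the shape of the current cylinder. Lebesgue measure on a
   unit interval is the chain started at [s = 0], but the induction peels off the first digit, so
   every bound must hold from any starting state. For the contraction, the plain bound
   [digit_probs_lip] on the variation of the transition probabilities is too weak; summation by
   parts moves that variation onto differences of [g] at neighbouring states. Correlations between
   digits never have to be estimated: adding the Poisson corrector [drift] turns the centred count
   into a martingale with bounded steps, whose second moment grows linearly. Two devices keep
   integration theory small: Gauss means are differences [G 1 - G 0] of primitives, and sets
   described by digits are covered by measurable sets, with the covers built digit by digit. *)
Require Import Defs.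
From HB Require Import structures.
From mathcomp Require Import all_boot all_order all_algebra.
From mathcomp Require Import all_classical all_reals all_analysis.
From mathcomp Require Import ring lra.

Set Implicit Arguments.
Unset Strict Implicit.
Unset Printing Implicit Defensive.

Import Order.TTheory GRing.Theory Num.Theory.
Import numFieldNormedType.Exports.

Local Open Scope classical_set_scope.
Local Open Scope ring_scope.

(** * The digit chain and the contraction of its averaging operator *)

Section DigitKernel.
Context {R : realType}.
Implicit Types (s z B L : R) (u v : nat -> R) (g : R -> R) (k N : nat).

(* Throughout, the index k stands for the digit k + 1; digit_tail s k is the
   probability of a digit >= k + 1 in state s. *)
Definition digit_tail s k : R := (1 + s) / (k.+1%:R + s).

Definition digit_prob s k : R := digit_tail s k - digit_tail s k.+1.

Definition next_state s k : R := (k.+1%:R + s)^-1.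

Definition digit_sum s u N : R := \sum_(0 <= k < N) digit_prob s k * u k.

Definition digit_mean s u : R := limn (digit_sum s u).

Lemma digit_tail0 s : 0 <= s -> digit_tail s 0 = 1.
Proof. by move=> s0; rewrite /digit_tail divff// gt_eqF//; lra. Qed.

Lemma natS_ge1 k : 1 <= k.+1%:R :> R.
Proof. by rewrite ler1n. Qed.

Lemma digit_tail_ge0 s k : 0 <= s -> 0 <= digit_tail s k.
Proof. by move=> s0; rewrite divr_ge0 ?addr_ge0. Qed.

Lemma digit_probE s k : 0 <= s ->
  digit_prob s k = (1 + s) / ((k.+1%:R + s) * (k.+2%:R + s)).
Proof.
move=> s0; rewrite /digit_prob /digit_tail -[in k.+2%:R]addn1 natrD.
have k1 := natS_ge1 k; set x := k.+1%:R in k1 *.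
by field; apply/andP; split; apply: lt0r_neq0; lra.
Qed.

Lemma digit_prob_ge0 s k : 0 <= s -> 0 <= digit_prob s k.
Proof.
move=> s0; rewrite digit_probE//.
have := natS_ge1 k; have := natS_ge1 k.+1 => k1 k2.
by apply: divr_ge0; [|apply: mulr_ge0]; lra.
Qed.

Lemma next_state_ge0 s k : 0 <= s -> 0 <= next_state s k.
Proof. by move=> s0; rewrite invr_ge0 addr_ge0. Qed.

Lemma next_state_le1 s k : 0 <= s -> next_state s k <= 1.
Proof.
by move=> s0; have := natS_ge1 k => k1; rewrite invf_le1; lra.
Qed.

Lemma sum_digit_prob s N M : (N <= M)%N ->
  \sum_(N <= k < M) digit_prob s k = digit_tail s N - digit_tail s M.
Proof.
move=> NM; rewrite (@telescope_sumr_eq _ _ _ (fun k => - digit_tail s k))//.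
  by rewrite opprK addrC.
by move=> k _; rewrite opprK addrC.
Qed.

Lemma digit_tail_le s k : 0 <= s -> digit_tail s k <= (1 + s) / k.+1%:R.
Proof.
move=> s0; have k1 := natS_ge1 k.
by rewrite ler_pM2l ?lef_pV2 ?posrE//; lra.
Qed.

Lemma cvg_digit_tail s : 0 <= s -> digit_tail s n @[n --> \oo] --> (0 : R).
Proof.
move=> s0; have h : (1 + s) * (n.+1%:R)^-1 @[n --> \oo] --> (1 + s) * 0.
  by apply: cvgZr; exact: cvg_harmonic.
rewrite mulr0 in h.
apply: (squeeze_cvgr _ (cvg_cst 0) h).
by near=> n; rewrite digit_tail_ge0//= digit_tail_le.
Unshelve. all: by end_near.
Qed.

Lemma cvg_sum_digit_prob s : 0 <= s ->
  \sum_(0 <= k < n) digit_prob s k @[n --> \oo] --> (1 : R).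
Proof.
move=> s0; under eq_fun do rewrite sum_digit_prob// digit_tail0//.
have h := cvgB (cvg_cst (1 : R)) (cvg_digit_tail s0).
by have := h _ _; rewrite subr0; apply.
Qed.

Lemma is_cvg_digit_sum s u B : 0 <= s -> (forall k, `|u k| <= B) ->
  cvgn (digit_sum s u).
Proof.
move=> s0 uB; apply: normed_cvg.
apply: (@series_le_cvg _ _ (fun k => B * digit_prob s k)) => [k|k|k|].
- exact: normr_ge0.
- by rewrite mulr_ge0 ?digit_prob_ge0// (le_trans _ (uB 0%N)).
- by rewrite /= normrM ger0_norm ?digit_prob_ge0// mulrC ler_wpM2r ?digit_prob_ge0.
- apply: is_cvg_seriesZ; apply/cvg_ex; exists 1; exact: cvg_sum_digit_prob.
Qed.

Lemma cvg_digit_sum s u B : 0 <= s -> (forall k, `|u k| <= B) ->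
  digit_sum s u n @[n --> \oo] --> digit_mean s u.
Proof. by move=> s0 uB; exact: is_cvg_digit_sum s0 uB. Qed.

Lemma digit_sum_tail s u B N M : 0 <= s -> (forall k, `|u k| <= B) ->
  (N <= M)%N -> `|digit_sum s u M - digit_sum s u N| <= B * digit_tail s N.
Proof.
move=> s0 uB NM; rewrite /digit_sum (big_cat_nat (leq0n N) NM)/= addrC addrK.
apply: le_trans (ler_norm_sum _ _ _) _.
have B0 : 0 <= B by apply: le_trans (uB 0%N).
apply: (@le_trans _ _ (\sum_(N <= k < M) B * digit_prob s k)).
  apply: ler_sum_nat => k _.
  by rewrite normrM ger0_norm ?digit_prob_ge0// mulrC ler_wpM2r ?digit_prob_ge0.
by rewrite -mulr_sumr sum_digit_prob// ler_wpM2l// gerBl digit_tail_ge0.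
Qed.

(** With [digit_tail_le] this is a truncation error of order 1/N, explicit in [s]; it later
    justifies integrating the mean term by term. *)
Lemma digit_mean_tail s u B N : 0 <= s -> (forall k, `|u k| <= B) ->
  `|digit_mean s u - digit_sum s u N| <= B * digit_tail s N.
Proof.
move=> s0 uB.
have c : `|digit_sum s u M - digit_sum s u N| @[M --> \oo] -->
    `|digit_mean s u - digit_sum s u N|.
  by apply: cvg_norm; apply: cvgB (cvg_cst _); exact: cvg_digit_sum uB.
rewrite -(cvg_lim _ c)//; apply: limr_le; first by apply/cvg_ex; eexists; exact: c.
by near=> M; apply: digit_sum_tail => //; near: M; exact: nbhs_infty_ge.
Unshelve. all: by end_near.
Qed.

Lemma digit_mean_bounds s u (a b : R) : 0 <= s -> (forall k, a <= u k <= b) ->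
  a <= digit_mean s u <= b.
Proof.
move=> s0 uab.
have uB k : `|u k| <= `|a| + `|b|.
  have /andP[h1 h2] := uab k; rewrite ler_norml.
  have := ler_norm b; have := ler_norm (- a); rewrite normrN.
  have := normr_ge0 a; have := normr_ge0 b; lra.
have cu := cvg_digit_sum s0 uB.
have c1 := cvg_sum_digit_prob s0.
apply/andP; split.
  have ca : a * \sum_(0 <= k < n) digit_prob s k @[n --> \oo] --> a * 1.
    exact: cvgZr.
  rewrite -[leLHS]mulr1; apply: (ler_cvg_to ca cu); near=> n.
  rewrite mulr_sumr; apply: ler_sum_nat => k _.
  by rewrite mulrC ler_wpM2l ?digit_prob_ge0//; case/andP: (uab k).
have cb : b * \sum_(0 <= k < n) digit_prob s k @[n --> \oo] --> b * 1.
  exact: cvgZr.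
rewrite -[leRHS]mulr1; apply: (ler_cvg_to cu cb); near=> n.
rewrite mulr_sumr; apply: ler_sum_nat => k _.
by rewrite [leRHS]mulrC ler_wpM2l ?digit_prob_ge0//; case/andP: (uab k).
Unshelve. all: by end_near.
Qed.

Lemma digit_tailB s s' k : 0 <= s -> 0 <= s' ->
  digit_tail s k - digit_tail s' k =
  (s - s') * (k%:R / ((k.+1%:R + s) * (k.+1%:R + s'))).
Proof.
move=> s0 s'0; rewrite /digit_tail -addn1 natrD.
have k0 : 0 <= k%:R :> R by [].
by field; apply/andP; split; apply: lt0r_neq0; lra.
Qed.

Lemma digit_tail_lip s s' k : 0 <= s -> 0 <= s' ->
  `|digit_tail s k - digit_tail s' k| <= `|s - s'| * (k%:R / k.+1%:R ^+ 2).
Proof.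
move=> s0 s'0; rewrite digit_tailB// normrM ler_wpM2l// ger0_norm; last first.
  by rewrite divr_ge0 ?mulr_ge0 ?addr_ge0.
have k1 := natS_ge1 k.
by rewrite ler_wpM2l// lef_pV2 ?posrE ?exprn_gt0 ?mulr_gt0// ?expr2 ?ler_pM//; lra.
Qed.

Lemma next_state_lip s s' k : 0 <= s -> 0 <= s' ->
  `|next_state s k - next_state s' k| =
  `|s - s'| / ((k.+1%:R + s) * (k.+1%:R + s')).
Proof.
move=> s0 s'0; have k1 := natS_ge1 k.
rewrite /next_state distV; [|lra..].
by rewrite opprD addrACA subrr add0r.
Qed.

Lemma next_state_succ s k : 0 <= s ->
  `|next_state s k.+1 - next_state s k| <= (k.+1%:R * k.+2%:R)^-1.
Proof.
move=> s0; have k1 := natS_ge1 k.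
have e : k.+2%:R = k.+1%:R + 1 :> R by rewrite natr1.
rewrite /next_state e; move: (k.+1%:R : R) k1 => x x1.
rewrite distV; [|lra..].
have -> : x + 1 + s - (x + s) = 1 by ring.
rewrite normr1 mul1r lef_pV2 ?posrE; [|apply: mulr_gt0; lra..].
by rewrite [leLHS]mulrC; apply: ler_pM; lra.
Qed.

(** By [digit_tailB] the difference is [s - s'] times a difference of consecutive terms of order
    1/k, hence of order 1/k^2; the bound is put in telescoping form. *)
Lemma digit_prob_lip s s' k : 0 <= s -> 0 <= s' ->
  `|digit_prob s k - digit_prob s' k| <=
  `|s - s'| * (2 * ((k.+1%:R)^-1 - (k.+2%:R)^-1)).
Proof.
move=> s0 s'0; have k0 : 0 <= k%:R :> R by [].
have -> : digit_prob s k - digit_prob s' k =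
    (s - s') * (k%:R / ((k.+1%:R + s) * (k.+1%:R + s')) -
                k.+1%:R / ((k.+2%:R + s) * (k.+2%:R + s'))).
  by rewrite mulrBr -!digit_tailB// /digit_prob; ring.
rewrite normrM ler_wpM2l//.
have -> : k.+2%:R = k%:R + 2 :> R by rewrite -addn2 natrD.
have -> : k.+1%:R = k%:R + 1 :> R by rewrite -addn1 natrD.
move: (k%:R : R) k0 => x x0.
have -> : 2 * ((x + 1)^-1 - (x + 2)^-1) = 2 / ((x + 1) * (x + 2)).
  by field; apply/andP; split; apply: lt0r_neq0; lra.
set a := x + 1 + s; set b := x + 1 + s'.
have -> : x + 2 + s = a + 1 by rewrite /a; ring.
have -> : x + 2 + s' = b + 1 by rewrite /b; ring.
have a1 : x + 1 <= a by rewrite /a; lra.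
have b1 : x + 1 <= b by rewrite /b; lra.
have [a0 b0] : 0 < a /\ 0 < b by split; lra.
have ab0 : 0 < a * b by rewrite mulr_gt0.
clearbody a b.
have -> : x / (a * b) - (x + 1) / ((a + 1) * (b + 1)) =
    (x * (a + b + 1) - a * b) / (a * b) / ((a + 1) * (b + 1)).
  by field; apply/and4P; split; apply: lt0r_neq0; lra.
rewrite normrM (@ger0_norm _ _^-1) ?invr_ge0 ?mulr_ge0//; [|lra..].
apply: ler_pM; rewrite ?invr_ge0 ?mulr_ge0//; [lra|lra| |].
  rewrite normrM normfV (gtr0_norm ab0) ler_pdivrMr//.
  rewrite ler_norml; apply/andP; split.
    have : 0 <= x * (a + b + 1) by apply: mulr_ge0; lra.
    lra.
  have : x * a <= (b - 1) * a by apply: ler_wpM2r; lra.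
  have : x * b <= (a - 1) * b by apply: ler_wpM2r; lra.
  lra.
rewrite lef_pV2 ?posrE; [|apply: mulr_gt0; lra..].
by rewrite [leLHS]mulrC; apply: ler_pM; lra.
Qed.

Definition lipschitz_ge0 L g :=
  forall s s', 0 <= s -> 0 <= s' -> `|g s - g s'| <= L * `|s - s'|.

Definition chain_op g s : R := digit_mean s (fun k => g (next_state s k)).

(** The slack [D / N.+1%:R] absorbs the boundary term of a summation by parts, which involves the
    sup norm but vanishes in the limit. *)
Lemma digit_mean_dist s s' u v B (C D : R) : 0 <= s -> 0 <= s' ->
  (forall k, `|u k| <= B) -> (forall k, `|v k| <= B) ->
  (forall N, `|digit_sum s u N - digit_sum s' v N| <= C + D / N.+1%:R) ->
  `|digit_mean s u - digit_mean s' v| <= C.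
Proof.
move=> s0 s'0 uB vB h.
have c1 : `|digit_sum s u N - digit_sum s' v N| @[N --> \oo] -->
    `|digit_mean s u - digit_mean s' v|.
  by apply: cvg_norm; apply: cvgB; [exact: cvg_digit_sum uB|exact: cvg_digit_sum vB].
have c2 : C + D * (N.+1%:R)^-1 @[N --> \oo] --> C + D * 0.
  by apply: cvgD; [exact: cvg_cst|apply: cvgZr; exact: cvg_harmonic].
rewrite mulr0 addr0 in c2.
by apply: (ler_cvg_to c1 c2); near=> N; exact: h.
Unshelve. all: by end_near.
Qed.

Lemma digit_probs_lip s s' N : 0 <= s -> 0 <= s' ->
  \sum_(0 <= k < N) `|digit_prob s k - digit_prob s' k| <= 2 * `|s - s'|.
Proof.
move=> s0 s'0.
apply: (@le_trans _ _ (\sum_(0 <= k < N)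
    `|s - s'| * (2 * ((k.+1%:R)^-1 - (k.+2%:R)^-1)))).
  by apply: ler_sum_nat => k _; exact: digit_prob_lip.
rewrite -mulr_sumr -mulr_sumr mulrCA ler_wpM2l// ler_piMr//.
rewrite (@telescope_sumr_eq _ _ _ (fun k => - (k.+1%:R)^-1))//; last first.
  by move=> k _; rewrite opprK addrC.
by rewrite opprK addrC invr1 gerBl invr_ge0.
Qed.

Lemma digit_mean_lip u B : (forall k, `|u k| <= B) ->
  lipschitz_ge0 (2 * B) (digit_mean ^~ u).
Proof.
move=> uB s s' s0 s'0; have B0 : 0 <= B by apply: le_trans (uB 0%N).
apply: (@digit_mean_dist s s' u u B _ 0) => // N.
rewrite mul0r addr0 /digit_sum -sumrB.
apply: le_trans (ler_norm_sum _ _ _) _.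
rewrite [leRHS]mulrAC; apply: le_trans (ler_wpM2r B0 (digit_probs_lip N s0 s'0)).
rewrite mulr_suml; apply: ler_sum_nat => k _.
by rewrite -mulrBl normrM ler_wpM2l.
Qed.

Let displacement s s' k : R := ((k.+1%:R + s) * (k.+1%:R + s'))^-1.

(** The digit 1 has probability p = 1/(2+s) <= 1/2 and displacement at most 1; every other digit has
    displacement at most 1/4. Hence the mean is at most p + (1-p)/4 <= 5/8. *)
Lemma mean_displacement s s' N : 0 <= s -> 0 <= s' ->
  \sum_(0 <= k < N) digit_prob s k * displacement s s' k <= 5 / 8.
Proof.
move=> s0 s'0; case: N => [|N]; first by rewrite big_geq//; lra.
have w k : displacement s s' k <= (k.+1%:R ^+ 2)^-1.
  have k1 := natS_ge1 k.
  rewrite lef_pV2 ?posrE ?exprn_gt0// ?mulr_gt0//; [|lra..].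
  by rewrite expr2; apply: ler_pM; lra.
have p0 : digit_prob s 0 <= 2^-1.
  rewrite digit_probE//; have -> : (1 + s) / ((1 + s) * (2 + s)) = (2 + s)^-1.
    by field; apply/andP; split; apply: lt0r_neq0; lra.
  by rewrite lef_pV2 ?posrE; lra.
have p00 := digit_prob_ge0 0 s0.
have : \sum_(0 <= k < N.+1) digit_prob s k * displacement s s' k <=
    digit_prob s 0 + (digit_tail s 1 - digit_tail s N.+1) / 4.
  elim: N => [|N IH].
    rewrite big_nat1 subrr mul0r addr0 ler_piMr//.
    by apply: le_trans (w 0%N) _; rewrite expr1n invr1.
  rewrite big_nat_recr//=; apply: le_trans (lerD IH (lexx _)) _.
  have -> : digit_tail s N.+2 = digit_tail s N.+1 - digit_prob s N.+1.
    by rewrite /digit_prob; ring.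
  have : displacement s s' N.+1 <= 4^-1.
    apply: le_trans (w _) _; rewrite lef_pV2 ?posrE ?exprn_gt0//.
    have : 2 <= N.+2%:R :> R by rewrite ler_nat.
    by move: (N.+2%:R : R) => x x2; rewrite expr2; nra.
  by move=> /(ler_wpM2l (digit_prob_ge0 N.+1 s0)); lra.
have -> : digit_tail s 1 = 1 - digit_prob s 0.
  by rewrite /digit_prob digit_tail0//; ring.
have := digit_tail_ge0 N.+1 s0; lra.
Qed.

Lemma summation_by_parts (d v : nat -> R) N : d 0%N = 0 ->
  \sum_(0 <= k < N) (d k - d k.+1) * v k =
  \sum_(0 <= k < N) d k.+1 * (v k.+1 - v k) - d N * v N.
Proof.
move=> d0; elim: N => [|N IH]; first by rewrite !big_geq// d0; ring.
by rewrite !big_nat_recr//= IH; ring.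
Qed.

(** The left side is 1/(k+2)^3, the right side 1/((k+1)(k+2)(k+3)). Summed over k the right side
    telescopes to 1/4, the share of the probabilities in the contraction factor. *)
Lemma inv_cube_telescope (k : nat) :
  k.+1%:R / k.+2%:R ^+ 2 * (k.+1%:R * k.+2%:R)^-1 <=
  2^-1 * ((k.+1%:R * k.+2%:R)^-1 - (k.+2%:R * k.+3%:R)^-1) :> R.
Proof.
have -> : k.+3%:R = k.+1%:R + 2 :> R by rewrite -!natr1; ring.
have -> : k.+2%:R = k.+1%:R + 1 :> R by rewrite -!natr1.
have := natS_ge1 k; move: (k.+1%:R : R) => x x1.
have -> : x / (x + 1) ^+ 2 * (x * (x + 1))^-1 = (x * (x + 2)) / (x * (x + 2) * (x + 1) ^+ 3).
  by field; apply/and3P; split; apply: lt0r_neq0; lra.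
have -> : 2^-1 * ((x * (x + 1))^-1 - ((x + 1) * (x + 2))^-1) =
    (x + 1) ^+ 2 / (x * (x + 2) * (x + 1) ^+ 3).
  by field; apply/and3P; split; apply: lt0r_neq0; lra.
rewrite ler_wpM2r ?invr_ge0 ?mulr_ge0 ?exprn_ge0//; [lra..|].
by rewrite expr2; nra.
Qed.

(* Moving the states contributes 5/8; the change of the probabilities
   contributes at most 1/4, after summation by parts. *)
Lemma chain_op_lip g L B : 0 <= L -> (forall s, 0 <= s -> `|g s| <= B) ->
  lipschitz_ge0 L g -> lipschitz_ge0 (7 / 8 * L) (chain_op g).
Proof.
move=> L0 gB gL s s' s0 s'0.
set u := fun k => g (next_state s k); set v := fun k => g (next_state s' k).
have vB k : `|v k| <= B by apply: gB; exact: next_state_ge0.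
have uB k : `|u k| <= B by apply: gB; exact: next_state_ge0.
have B0 : 0 <= B by apply: le_trans (uB 0%N).
apply: (@digit_mean_dist s s' u v B _ (`|s - s'| * B)) => // N.
pose d k := digit_tail s k - digit_tail s' k.
(* The states change first, under the law of [s]; then the law changes with the states of [s']
   fixed. Both tails equal 1 at index 0, so [d 0 = 0]. *)
have -> : digit_sum s u N - digit_sum s' v N =
    \sum_(0 <= k < N) digit_prob s k * (u k - v k) +
    (\sum_(0 <= k < N) d k.+1 * (v k.+1 - v k) - d N * v N).
  rewrite -summation_by_parts; last by rewrite /d !digit_tail0// subrr.
  rewrite -sumrB -big_split; apply: eq_bigr => k _ /=.
  by rewrite /d /digit_prob; ring.
have h1 : `|\sum_(0 <= k < N) digit_prob s k * (u k - v k)| <=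
    5 / 8 * (L * `|s - s'|).
  apply: le_trans (ler_norm_sum _ _ _) _.
  have Ls : 0 <= L * `|s - s'| by rewrite mulr_ge0.
  apply: le_trans (ler_wpM2r Ls (mean_displacement N s0 s'0)).
  rewrite mulr_suml; apply: ler_sum_nat => k _.
  rewrite normrM ger0_norm ?digit_prob_ge0// -mulrA ler_wpM2l ?digit_prob_ge0//.
  apply: le_trans (gL _ _ (next_state_ge0 k s0) (next_state_ge0 k s'0)) _.
  by rewrite next_state_lip// mulrA mulrC.
have h2 : `|\sum_(0 <= k < N) d k.+1 * (v k.+1 - v k)| <= 4^-1 * (L * `|s - s'|).
  apply: le_trans (ler_norm_sum _ _ _) _.
  apply: (@le_trans _ _ (\sum_(0 <= k < N) `|s - s'| * (L * (2^-1 *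
      ((k.+1%:R * k.+2%:R)^-1 - (k.+2%:R * k.+3%:R)^-1))))).
    apply: ler_sum_nat => k _; rewrite normrM.
    apply: (@le_trans _ _ (`|s - s'| * (k.+1%:R / k.+2%:R ^+ 2) *
        (L * (k.+1%:R * k.+2%:R)^-1))).
      apply: ler_pM => //; first exact: digit_tail_lip.
      apply: le_trans (gL _ _ (next_state_ge0 _ s'0) (next_state_ge0 _ s'0)) _.
      by rewrite ler_wpM2l// next_state_succ.
    rewrite -mulrA ler_wpM2l// mulrCA ler_wpM2l//; exact: inv_cube_telescope.
  have : \sum_(0 <= k < N) ((k.+1%:R * k.+2%:R)^-1 - (k.+2%:R * k.+3%:R)^-1) <=
      2^-1 :> R.
    rewrite (@telescope_sumr_eq _ _ _ (fun k => - (k.+1%:R * k.+2%:R)^-1))//.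
      by rewrite opprK mul1r gerDr oppr_le0 invr_ge0 mulr_ge0.
    by move=> k _; rewrite opprK addrC.
  rewrite -!mulr_sumr => /(ler_wpM2l (mulr_ge0 L0 (normr_ge0 (s - s')))).
  lra.
have h3 : `|d N * v N| <= `|s - s'| * B / N.+1%:R.
  rewrite normrM mulrAC; apply: ler_pM => //.
  apply: le_trans (digit_tail_lip N s0 s'0) _; rewrite ler_wpM2l//.
  have : N%:R <= N.+1%:R :> R by rewrite ler_nat.
  have := natS_ge1 N; move: (N.+1%:R : R) (N%:R : R) => x y x1 yx.
  rewrite expr2 invfM mulrA ler_piMl ?invr_ge0//; first lra.
  by rewrite ler_pdivrMr; lra.
apply: le_trans (ler_normD _ _) _.
apply: le_trans (lerD h1 (le_trans (ler_normB _ _) (lerD h2 h3))) _.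
by move: (`|s - s'| * B / _) => e; lra.
Qed.

Lemma chain_op_bounds g (a b : R) : (forall s, 0 <= s -> a <= g s <= b) ->
  forall s, 0 <= s -> a <= chain_op g s <= b.
Proof.
by move=> gab s s0; apply: digit_mean_bounds => // k; apply: gab; exact: next_state_ge0.
Qed.

End DigitKernel.

(** * Gauss means computed through primitives *)

Section GaussMean.
Context {R : realType}.
Implicit Types (f g G : R -> R) (s x : R) (A : pred nat).

Lemma MVT_01 (H h : R -> R) : (forall x, 0 <= x <= 1 -> is_derive x 1 H (h x)) ->
  exists2 c, 0 < c < 1 & H 1 - H 0 = h c.
Proof.
move=> Hh; have [||c] := @MVT _ H h 0 1 ltr01.
- by move=> x; rewrite in_itv/= => /andP[x0 x1]; apply: Hh; rewrite !ltW.
- apply: derivable_within_continuous => x; rewrite in_itv/= => x01.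
  by have [] := Hh x x01.
by rewrite in_itv/= => c01; rewrite subr0 mulr1; exists c.
Qed.

(** Integrating from -1 makes 0 an interior point, so that the derivative there is two-sided. *)
Lemma continuous_antiderivative f : continuous f ->
  exists F : R -> R, forall x, -1 < x -> is_derive x 1 F (f x).
Proof.
move=> cf; exists (fun x => \int[lebesgue_measure]_(t in `[-1, x]) f t)%R => x x1.
have xu : x < x + 1 by lra.
have fi : lebesgue_measure.-integrable `[-1, x + 1] (EFin \o f).
  apply: continuous_compact_integrable; first exact: segment_compact.
  exact: continuous_subspaceT.
have [dF F'] := continuous_FTC1_closed xu fi x1 (cf x).
by apply: DeriveDef; [exact: dF|rewrite -derive1E].
Qed.

Lemma is_derive_ln_shift (a x : R) : 0 < a + x ->
  is_derive x 1 (fun s => ln (a + s)) (a + x)^-1.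
Proof.
move=> ax; have h1 : is_derive x 1 (fun s => a + s) 1.
  have := is_deriveD (is_derive_cst a x 1) (is_derive_id x 1).
  by rewrite add0r.
by have := is_derive1_comp (is_derive1_ln ax) h1; rewrite mulr1.
Qed.

Lemma is_derive_next_state (k : nat) x : 0 <= x ->
  is_derive x 1 (next_state ^~ k) (- (k.+1%:R + x) ^- 2).
Proof.
move=> x0; have h1 : is_derive x 1 (fun s => k.+1%:R + s) 1.
  have := is_deriveD (is_derive_cst (k.+1%:R : R) x 1) (is_derive_id x 1).
  by rewrite add0r.
have k1 := @natS_ge1 R k.
have nz : k.+1%:R + x != 0 by apply: lt0r_neq0; lra.
by have := is_deriveV nz h1; rewrite [_ *: _]mulr1.
Qed.

(** [G 1 - G 0] is then the integral of [g] over [0, 1] against ds/(1+s), that is, [ln 2] times the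
    Gauss mean. Integral estimates become applications of the mean value theorem. *)
Definition gauss_primitive g G :=
  forall x, 0 <= x -> is_derive x 1 G (g x / (1 + x)).

Lemma lipschitz_gauss_primitive g (L : R) : lipschitz_ge0 L g ->
  exists G, gauss_primitive g G.
Proof.
move=> gL.
(* [g] is controlled on nonnegative arguments only; its even extension is continuous everywhere. *)
have cg : continuous (fun x => g `|x|).
  move=> x; apply/cvgrPdist_lt => e e0.
  have L0 : 0 <= L.
    have := gL 1 0 ler01 (lexx 0); rewrite subr0 normr1 mulr1; exact: le_trans.
  near=> y.
  apply: le_lt_trans (gL _ _ (normr_ge0 _) (normr_ge0 _)) _.
  have h : `|(`|x| - `|y|)| <= `|x - y| by exact: ler_dist_dist.
  apply: le_lt_trans (ler_wpM2l L0 h) _.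
  apply: (@le_lt_trans _ _ ((L + 1) * `|x - y|)); first by rewrite ler_wpM2r// lerDl.
  rewrite -ltr_pdivlMl; last lra.
  near: y; move/cvgrPdist_lt: (@cvg_id _ (nbhs x)); apply.
  by rewrite mulr_gt0 ?invr_gt0//; lra.
have cf : continuous (fun x => g `|x| / (1 + `|x|)).
  move=> x; apply: cvgM; first exact: cg.
  apply: cvgV; first by apply: lt0r_neq0; have := normr_ge0 x; lra.
  by apply: cvgD; [exact: cvg_cst|exact: norm_continuous].
have [G hG] := continuous_antiderivative cf.
exists G => x x0; have := hG x; rewrite ger0_norm//; apply; lra.
Unshelve. all: by end_near.
Qed.

Lemma gauss_primitive_diff_bounds g G (a b : R) : gauss_primitive g G ->
  (forall x, 0 <= x <= 1 -> a <= g x <= b) ->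
  a * ln 2 <= G 1 - G 0 <= b * ln 2.
Proof.
move=> gG gab.
(* Subtracting [c * ln (1 + s)], the primitive for the constant [c], leaves a difference with the
   sign of [g x - c] at some [x]; it is used with [c = a] and [c = b]. *)
have key (c : R) : exists2 x, 0 < x < 1 &
    G 1 - G 0 - c * ln 2 = (g x - c) / (1 + x).
  have [|x x01 e] := @MVT_01 (fun s => G s - c * ln (1 + s))
    (fun s => (g s - c) / (1 + s)).
    move=> s /andP[s0 s1]; rewrite mulrBl.
    apply: is_deriveB; first exact: gG.
    by apply: is_deriveZ; apply: is_derive_ln_shift; lra.
  exists x => //; rewrite -e addr0 ln1 mulr0.
  by have -> : 1 + 1 = 2 :> R by []; ring.
apply/andP; split.
  have [x /andP[x0 x1] e] := key a; rewrite -subr_ge0 e.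
  have /andP[h1 h2] : a <= g x <= b by apply: gab; rewrite !ltW.
  by rewrite divr_ge0//; lra.
have [x /andP[x0 x1] e] := key b; rewrite -subr_le0 e.
have /andP[h1 h2] : a <= g x <= b by apply: gab; rewrite !ltW.
by rewrite pmulr_lle0 ?invr_gt0; lra.
Qed.

(** Term-by-term integration. The mean value theorem is applied to [G] minus a partial sum of the
    [U k]: the derivative is a tail of the mean divided by 1+s, and the factor 1+s in
    [digit_tail_le] cancels, which leaves B/(N+1). *)
Lemma gauss_mean_exchange (u U : nat -> R -> R) G (B : R) :
  (forall k s, 0 <= s -> `|u k s| <= B) ->
  (forall k s, 0 <= s ->
     is_derive s 1 (U k) (digit_prob s k * u k s / (1 + s))) ->
  gauss_primitive (fun s => digit_mean s (u ^~ s)) G ->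
  \sum_(0 <= k < N) (U k 1 - U k 0) @[N --> \oo] --> G 1 - G 0.
Proof.
move=> uB dU dG.
have B0 : 0 <= B by apply: le_trans (uB 0%N 0 (lexx _)).
have key N : `|(G 1 - G 0) - \sum_(0 <= k < N) (U k 1 - U k 0)| <= B * (N.+1%:R)^-1.
  have [|x /andP[x0 x1] e] := @MVT_01 (fun s => G s - \sum_(0 <= k < N) U k s)
    (fun s => (digit_mean s (u ^~ s) - digit_sum s (u ^~ s) N) / (1 + s)).
    move=> s /andP[s0 s1]; rewrite mulrBl; apply: is_deriveB; first exact: dG.
    rewrite /digit_sum mulr_suml; elim: N => [|N IH].
      under [X in is_derive _ _ X]eq_fun do rewrite big_geq//.
      by rewrite big_geq//; exact: is_derive_cst.
    under [X in is_derive _ _ X]eq_fun do rewrite big_nat_recr//=.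
    by rewrite big_nat_recr//=; apply: is_deriveD => //; exact: dU.
  have -> : G 1 - G 0 - \sum_(0 <= k < N) (U k 1 - U k 0) =
      G 1 - \sum_(0 <= k < N) U k 1 - (G 0 - \sum_(0 <= k < N) U k 0).
    by rewrite sumrB; ring.
  rewrite e normrM [X in _ * X]ger0_norm ?invr_ge0; last lra.
  rewrite ler_pdivrMr; last lra.
  have xx := ltW x0.
  apply: le_trans (@digit_mean_tail _ _ _ B N xx (fun k => uB k x xx)) _.
  by rewrite -mulrA ler_wpM2l// mulrC; exact: digit_tail_le.
apply/cvgrPdist_le => e e0.
have h : B * (N.+1%:R)^-1 @[N --> \oo] --> B * 0.
  by apply: cvgZr; exact: cvg_harmonic.
rewrite mulr0 in h.
move/cvgrPdist_le : h => /(_ _ e0); apply: filterS => N.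
rewrite sub0r normrN => h; apply: le_trans (key N) _.
exact: le_trans (ler_norm _) h.
Qed.

(** The integral of ds/(1+s) from 1/(k+2) to 1/(k+1), the interval where the first digit is k+1; not
    yet divided by [ln 2]. *)
Definition gauss_weight (k : nat) : R :=
  ln (k.+2%:R / k.+1%:R) - ln (k.+3%:R / k.+2%:R).

Lemma gauss_weightE k : gauss_weight k = - ln (1 - (k.+2%:R ^+ 2)^-1).
Proof.
have -> : 1 - (k.+2%:R ^+ 2)^-1 = (k.+2%:R / k.+1%:R / (k.+3%:R / k.+2%:R))^-1 :> R.
  have -> : k.+3%:R = k.+1%:R + 2 :> R by rewrite -!natr1; ring.
  have -> : k.+2%:R = k.+1%:R + 1 :> R by rewrite -!natr1.
  have := @natS_ge1 R k; move: (k.+1%:R : R) => x x1.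
  by field; apply/and3P; split; apply: lt0r_neq0; lra.
by rewrite lnV ?posrE ?divr_gt0// opprK ln_div ?posrE ?divr_gt0.
Qed.

Lemma gauss_mean_digits A G :
  gauss_primitive (fun s => digit_mean s (fun k => (A k)%:R)) G ->
  \sum_(0 <= k < N) (A k)%:R * gauss_weight k @[N --> \oo] --> G 1 - G 0.
Proof.
(* [digit_prob s k / (1 + s)] is 1/((k+1+s)(k+2+s)); [U] integrates its partial fractions. *)
move=> dG; pose U k s : R := (A k)%:R * (ln (k.+1%:R + s) - ln (k.+2%:R + s)).
have h := @gauss_mean_exchange (fun k _ => (A k)%:R) U G 1.
have -> : (fun N => \sum_(0 <= k < N) (A k)%:R * gauss_weight k) =
    (fun N => \sum_(0 <= k < N) (U k 1 - U k 0)).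
  apply/funext => N; apply: eq_bigr => k _.
  by rewrite /U /gauss_weight !addr0 !ln_div ?posrE// !natr1; ring.
apply: h => // [k s s0|k s s0]; first by case: (A k); rewrite ?normr1 ?normr0.
have k1 := @natS_ge1 R k; have k2 := @natS_ge1 R k.+1.
apply: is_derive_eq.
  apply: is_deriveZ; apply: is_deriveB; apply: is_derive_ln_shift; lra.
rewrite digit_probE// [_ *: _]mulrC.
have -> : k.+2%:R = k.+1%:R + 1 :> R by rewrite natr1.
move: (k.+1%:R : R) k1 => x x1.
by field; apply/and3P; split; apply: lt0r_neq0; lra.
Qed.

(** Invariance of the Gauss measure. Substituting t = [next_state s k] turns [digit_prob s k]
    ds/(1+s) into -dt/(1+t), so [- G (next_state s k)] is a primitive of the k-th term. The images
    of [0, 1] are the adjacent intervals [1/(k+2), 1/(k+1)], so the increments telescope, and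
    continuity of [G] at 0 gives the limit. *)
Lemma gauss_mean_chain_op g G G' (B : R) :
  (forall s, 0 <= s -> `|g s| <= B) ->
  gauss_primitive g G -> gauss_primitive (chain_op g) G' ->
  G' 1 - G' 0 = G 1 - G 0.
Proof.
move=> gB dG dG'; pose U k s : R := - G (next_state s k).
have h : \sum_(0 <= k < N) (U k 1 - U k 0) @[N --> \oo] --> G' 1 - G' 0.
  apply: (@gauss_mean_exchange (fun k s => g (next_state s k)) U G' B) => //.
    by move=> k s s0; apply: gB; exact: next_state_ge0.
  move=> k s s0; have k1 := @natS_ge1 R k; have k2 := @natS_ge1 R k.+1.
  apply: is_derive_eq.
    apply: is_deriveN; apply: is_derive1_comp.
      by apply: dG; exact: next_state_ge0.
    exact: is_derive_next_state.
  rewrite digit_probE// /next_state.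
  move: (g _) => y.
  have -> : k.+2%:R = k.+1%:R + 1 :> R by rewrite natr1.
  move: (k.+1%:R : R) k1 => x x1.
  by field; do ?[apply/andP; split]; apply: lt0r_neq0; lra.
have tel N : \sum_(0 <= k < N) (U k 1 - U k 0) = G 1 - G (N.+1%:R)^-1.
  rewrite (@telescope_sumr_eq _ _ _ (fun k => - G (k.+1%:R)^-1))//.
    by rewrite invr1 opprK addrC.
  by move=> k _; rewrite /U /next_state addr0 natr1.
have h' : G 1 - G (N.+1%:R)^-1 @[N --> \oo] --> G 1 - G 0.
  apply: cvgB; first exact: cvg_cst.
  have cG : {for 0, continuous G}.
    apply: differentiable_continuous; apply/derivable1_diffP.
    by have [] := dG 0 (lexx 0).
  by apply: (continuous_cvg _ cG); exact: cvg_harmonic.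
rewrite -(cvg_lim _ h)// -(cvg_lim _ h')//.
by congr (limn _); apply/funext => N; rewrite tel.
Qed.

End GaussMean.

(** * Mean and second moment of the digit count *)

Section SecondMoment.
Context {R : realType}.
Implicit Types (s z : R) (A : pred nat) (n N k : nat).

(** The probability, from state [s], that [A] contains the index of the digit that follows [n]
    further digits. *)
Definition digit_indicator_mean A n s : R :=
  iter n chain_op (digit_mean ^~ (fun k => (A k)%:R)) s.

Lemma digit_indicator_mean_bounds A n s : 0 <= s ->
  0 <= digit_indicator_mean A n s <= 1.
Proof.
elim: n s => [|n IH] s s0; last exact: chain_op_bounds.
by apply: digit_mean_bounds => // k; case: (A k); rewrite /= ?lexx ?ler01.
Qed.

Lemma digit_indicator_mean_norm A n s : 0 <= s ->
  `|digit_indicator_mean A n s| <= 1.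
Proof.
by move=> s0; have /andP[h0 h1] := digit_indicator_mean_bounds A n s0; rewrite ger0_norm.
Qed.

Lemma digit_indicator_mean_lip A n :
  lipschitz_ge0 ((7 / 8) ^+ n * 2) (digit_indicator_mean A n).
Proof.
elim: n => [|n IH].
  rewrite mul1r -[2]mulr1; apply: digit_mean_lip => k.
  by case: (A k); rewrite ?normr1 ?normr0.
rewrite exprS -mulrA; apply: (@chain_op_lip _ _ _ 1) => //.
by move=> s s0; exact: digit_indicator_mean_norm.
Qed.

(** Invariance gives all iterates the same Gauss mean [c], and on [0, 1] a function with Lipschitz
    constant e stays within e of its mean. *)
Lemma digit_indicator_mean_decay A : exists c : R,
  [/\ 0 <= c <= 1,
      \sum_(0 <= k < N) (A k)%:R * gauss_weight k @[N --> \oo] --> c * ln 2 &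
      forall n s, 0 <= s <= 1 ->
        `|digit_indicator_mean A n s - c| <= (7 / 8) ^+ n * 2].
Proof.
have ln20 : 0 < ln 2 :> R by rewrite ln_gt0// ltr1n.
have [G dG] := lipschitz_gauss_primitive (digit_indicator_mean_lip A 0).
pose c := (G 1 - G 0) / ln 2.
have cE : G 1 - G 0 = c * ln 2 by rewrite /c divfK// gt_eqF.
have dGn n : exists2 Gn, gauss_primitive (digit_indicator_mean A n) Gn &
    Gn 1 - Gn 0 = c * ln 2.
  elim: n => [|n [Gn dGn GnE]]; first by exists G.
  have [G' dG'] := lipschitz_gauss_primitive (digit_indicator_mean_lip A n.+1).
  exists G' => //; rewrite -GnE; apply: gauss_mean_chain_op dGn dG' => s s0.
  exact: digit_indicator_mean_norm.
exists c; split.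
- have := @gauss_primitive_diff_bounds R _ G 0 1 dG; rewrite cE mul0r mul1r.
  have h x : 0 <= x <= 1 -> 0 <= digit_indicator_mean A 0 x <= 1.
    by move=> /andP[x0 _]; exact: digit_indicator_mean_bounds.
  move=> /(_ h) /andP[h0 h1]; rewrite -(ler_pM2r ln20) mul0r h0/=.
  by rewrite -(ler_pM2r ln20) mul1r.
- by rewrite -cE; exact: gauss_mean_digits.
- move=> n s /andP[s0 s1]; set e := (7 / 8) ^+ n * 2.
  have e0 : 0 <= e by rewrite mulr_ge0// exprn_ge0//; lra.
  have [Gn dGn' GnE] := dGn n.
  set y := digit_indicator_mean A n s.
  have := @gauss_primitive_diff_bounds R _ Gn (y - e) (y + e) dGn'.
  have h x : 0 <= x <= 1 -> y - e <= digit_indicator_mean A n x <= y + e.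
    move=> /andP[x0 x1]; rewrite -ler_distl.
    apply: le_trans (digit_indicator_mean_lip A n x0 s0) _.
    by rewrite -/e ler_piMr// ler_norml; apply/andP; split; lra.
  move=> /(_ h); rewrite GnE !ler_pM2r// => /andP[h1 h2].
  by rewrite ler_distl; apply/andP; split; lra.
Qed.

(* The partial sums of the solution of the Poisson equation
   D - chain_op D = digit_mean A - c. *)
Definition drift A (c : R) n s : R :=
  \sum_(0 <= j < n) (digit_indicator_mean A j s - c).

Section FixedDigitSet.
Context (A : pred nat) (c : R) (c01 : 0 <= c <= 1).
Hypothesis decay : forall n s, 0 <= s <= 1 ->
  `|digit_indicator_mean A n s - c| <= (7 / 8) ^+ n * 2.

Let next_state01 s k : 0 <= s -> 0 <= next_state s k <= 1.
Proof. by move=> s0; rewrite next_state_ge0// next_state_le1. Qed.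

(** The geometric series 2 * (7/8)^j has sum 16; the induction keeps its exact partial sums. *)
Lemma drift_bound n s : 0 <= s <= 1 -> `|drift A c n s| <= 16.
Proof.
move=> s01; suff : `|drift A c n s| <= 16 - 16 * (7 / 8) ^+ n.
  have : 0 <= (7 / 8) ^+ n :> R by rewrite exprn_ge0//; lra.
  lra.
elim: n => [|n IH]; first by rewrite /drift big_geq// normr0 expr0; lra.
rewrite /drift big_nat_recr//=; apply: le_trans (ler_normD _ _) _.
apply: le_trans (lerD IH (decay n s01)) _; rewrite exprS; lra.
Qed.

Let increment n s k : R := (A k)%:R - c + drift A c n (next_state s k).

Lemma increment_bound n s k : 0 <= s -> `|increment n s k| <= 17.
Proof.
move=> s0; apply: le_trans (ler_normD _ _) _.
have := drift_bound n (next_state01 k s0).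
have : `|(A k)%:R - c| <= 1.
  by case/andP: c01 => c0 c1; rewrite ler_norml; case: (A k) => /=; apply/andP; split; lra.
lra.
Qed.

(** The Poisson equation with finite horizon: averaging over the next digit sends [drift A c n] to
    the terms 1, ..., n of [drift A c n.+1], and the indicator minus [c] supplies the term 0. *)
Lemma cvg_increment n s : 0 <= s ->
  digit_sum s (increment n s) N @[N --> \oo] --> drift A c n.+1 s.
Proof.
move=> s0.
have cc : c * \sum_(0 <= k < N) digit_prob s k @[N --> \oo] --> c * 1.
  by apply: cvgZr; exact: cvg_sum_digit_prob.
rewrite mulr1 in cc.
elim: n => [|n IH].
  have -> : digit_sum s (increment 0 s) =
      (fun N => digit_sum s (fun k => (A k)%:R) N -
                c * \sum_(0 <= k < N) digit_prob s k).
    apply/funext => N; rewrite /digit_sum mulr_sumr -sumrB.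
    by apply: eq_bigr => k _; rewrite /increment /drift big_geq//; ring.
  rewrite /drift big_nat1; apply: cvgB => //.
  apply: (@cvg_digit_sum _ _ _ 1) => // k.
  by case: (A k); rewrite ?normr1 ?normr0.
have -> : digit_sum s (increment n.+1 s) =
    (fun N => digit_sum s (increment n s) N +
      (digit_sum s (fun k => digit_indicator_mean A n (next_state s k)) N -
                c * \sum_(0 <= k < N) digit_prob s k)).
  apply/funext => N; rewrite /digit_sum mulr_sumr -sumrB -big_split/=.
  by apply: eq_bigr => k _; rewrite /increment /drift big_nat_recr//=; ring.
rewrite /drift big_nat_recr//=; apply: cvgD => //; apply: cvgB => //.
apply: (@cvg_digit_sum _ _ _ 1) => // k.
by apply: digit_indicator_mean_norm; exact: next_state_ge0.
Qed.

(* Bounds the expectation of (z + S_n - n c)^2 from state s, where S_n counts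
   the digits in A; 289 = (1 + 16)^2 with 16 from drift_bound. *)
Definition moment_bound n s z : R := (z + drift A c n s) ^+ 2 + 289 * n%:R.

Lemma moment_bound_ge0 n s z : 0 <= moment_bound n s z.
Proof. exact: addr_ge0 (sqr_ge0 _) (mulr_ge0 (ler0n R 289) (ler0n R n)). Qed.

(** Expanding the square around [z], the cross term averages to [2 * z * drift A c n.+1 s] and the
    squared increment is at most 17^2 = 289; completing the square only adds a nonnegative term. *)
Lemma moment_bound_step n s z N : 0 <= s ->
  \sum_(0 <= k < N)
     digit_prob s k * moment_bound n (next_state s k) (z + ((A k)%:R - c)) <=
  moment_bound n.+1 s z.
Proof.
move=> s0; pose S N := \sum_(0 <= k < N)
  digit_prob s k * moment_bound n (next_state s k) (z + ((A k)%:R - c)).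
rewrite -/(S N).
(* The cross term has no fixed sign, so it is kept as a partial sum and evaluated only in the limit;
   [S] is nondecreasing, which carries the bound back to [N]. *)
have SM M : S M <= z ^+ 2 + 289 * n.+1%:R + 2 * z * digit_sum s (increment n s) M.
  rewrite /S /digit_sum.
  have h k : digit_prob s k * moment_bound n (next_state s k) (z + ((A k)%:R - c)) <=
      digit_prob s k * (z ^+ 2 + 289 * n.+1%:R) +
      2 * z * (digit_prob s k * increment n s k).
    have -> : 2 * z * (digit_prob s k * increment n s k) =
      digit_prob s k * (2 * z * increment n s k) by ring.
    rewrite -mulrDr ler_wpM2l ?digit_prob_ge0//.
    rewrite /moment_bound -addrA -/(increment n s k).
    have : increment n s k ^+ 2 <= 17 ^+ 2.
      rewrite -[leLHS]ger0_norm ?sqr_ge0// normrX.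
      by apply: lerXn2r; rewrite ?nnegrE// increment_bound.
    rewrite -[n.+1%:R]natr1.
    move: (increment n s k) (n%:R : R) => x y hx; nra.
  apply: le_trans (ler_sum_nat _) _; first by move=> k _; exact: h.
  rewrite big_split/= -mulr_suml -mulr_sumr lerD2r; apply: ler_piMl.
    exact: addr_ge0 (sqr_ge0 _) (mulr_ge0 (ler0n R 289) (ler0n R _)).
  by rewrite sum_digit_prob// digit_tail0// gerBl digit_tail_ge0.
have c1 : z ^+ 2 + 289 * n.+1%:R + 2 * z * digit_sum s (increment n s) M
    @[M --> \oo] --> z ^+ 2 + 289 * n.+1%:R + 2 * z * drift A c n.+1 s.
  by apply: cvgD; [exact: cvg_cst|apply: cvgZr; exact: cvg_increment].
have : S N <= z ^+ 2 + 289 * n.+1%:R + 2 * z * drift A c n.+1 s.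
  apply: (ler_cvg_to (cvg_cst (S N)) c1); near=> M.
  apply: le_trans (SM M); rewrite /S.
  have NM : (N <= M)%N by near: M; exact: nbhs_infty_ge.
  rewrite (big_cat_nat (leq0n N) NM)/= lerDl; apply: sumr_ge0 => k _.
  by rewrite mulr_ge0 ?digit_prob_ge0 ?moment_bound_ge0.
move/le_trans; apply; rewrite /moment_bound.
move: (drift _ _ _ _) => x; have := sqr_ge0 x; nra.
Unshelve. all: by end_near.
Qed.

End FixedDigitSet.
End SecondMoment.

(** * Peeling off the first digit of an irrational number *)

Section DigitCount.
Context {R : realType}.
Implicit Types (x y : R) (D : set int) (n k : nat).

Definition digit_count D x n : nat := count (fun i => cf_digit x i \in D) (iota 1 n).

Lemma cf_step_subz x (m : int) : cf_step (x - m%:~R) = cf_step x.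
Proof.
rewrite /cf_step; congr (_^-1).
have -> : Num.floor (x - m%:~R) = Num.floor x - m.
  apply: floor_def; have /andP[h1 h2] := floor_itv x.
  by move: h1 h2; rewrite !intrD intrN; move=> h1 h2; apply/andP; split; lra.
by rewrite intrD intrN; ring.
Qed.

(** The count starts at index 1, and subtracting an integer affects only the digit of index 0. *)
Lemma digit_count_subz D x (m : int) n :
  digit_count D (x - m%:~R) n = digit_count D x n.
Proof.
apply: eq_in_count => i; rewrite mem_iota => /andP[i0 _].
by case: i i0 => // i _; rewrite !cf_digitS cf_step_subz.
Qed.

Lemma floor_lt1 y : 0 < y < 1 -> Num.floor y = 0.
Proof. by move=> /andP[y0 y1]; apply: floor_def; rewrite add0r ltW. Qed.

Lemma first_digit y : irrational y -> 0 < y < 1 ->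
  exists k (y' : R), [/\ irrational y', 0 < y' < 1, y = (k.+1%:R + y')^-1 &
    forall D n, digit_count D y n.+1 = ((k.+1%:Z \in D) + digit_count D y' n)%N].
Proof.
move=> iy y01.
have yE : cf_step y = y^-1 by rewrite /cf_step floor_lt1// subr0.
have is' := irrational_step iy; have s1 := cf_step_gt1 iy.
have : 0 < Num.floor (cf_step y) by rewrite floor_gt0 ltW.
have := irrational_fracP is'; have := @irrationalBz R _ (Num.floor (cf_step y)) is'.
have := fun D n => digit_count_subz D (cf_step y) (Num.floor (cf_step y)) n.
case e : (Num.floor (cf_step y)) => [[|k]|]// hc iy' y'01 _.
exists k, (cf_step y - k.+1%:R); split => //.
  by rewrite addrC subrK yE invrK.
move=> D n; rewrite (hc D n) /digit_count /= cf_digitS /cf_digit /= e; congr (_ + _)%N.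
rewrite (iotaDl 1 1) count_map; apply: eq_count => i /=.
by rewrite add0n -iterS iterSr.
Qed.

End DigitCount.

(** * Chebyshev's inequality on cylinders *)

Section CylinderCover.
Context {R : realType}.
Local Notation mu := (@lebesgue_measure R).

(** An outer measure bound with an explicit measurable cover, so that sets defined by digit counts
    can be estimated without a measurability proof. *)
Definition outer_le (S : set R) (v : R) : Prop :=
  exists M : set R, [/\ measurable M, S `<=` M & (mu M <= v%:E)%E].

Lemma outer_le_bigcup (S : set R) (T : nat -> set R) (v : nat -> R) (w : R) :
  S `<=` \bigcup_k T k -> (forall k, 0 <= v k) -> (forall k, outer_le (T k) (v k)) ->
  (forall N, \sum_(0 <= k < N) v k <= w) -> outer_le S w.
Proof.
move=> ST v0 Tv vw; have [M hM] := choice Tv.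
have mM k : measurable (M k) by have [] := hM k.
exists (\bigcup_k M k); split.
- exact: bigcup_measurable.
- by apply: subset_trans ST _; apply: subset_bigcup => k _; have [] := hM k.
- apply: (@le_trans _ _ (\sum_(k <oo) mu (M k))%E).
    apply: measure_sigma_subadditive.
    - exact: mM.
    - apply: bigcup_measurable => k _; exact: mM.
    - exact: subset_refl.
  apply: (@le_trans _ _ (\sum_(k <oo) (v k)%:E)%E).
    by apply: lee_nneseries => // k _; have [] := hM k.
  apply: lime_le; first by apply: is_cvg_nneseries => k _ _; rewrite lee_fin.
  by apply: nearW => N; rewrite sumEFin lee_fin.
Qed.

Lemma outer_le_itv (S : set R) (a b v : R) : (forall x, S x -> a <= x <= b) ->
  b - a <= v -> 0 <= v -> outer_le S v.
Proof.
move=> Sab bav v0; exists `[a, b]%classic; split => //.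
rewrite lebesgue_measure_itv/=; case: ifP => _; first by rewrite -EFinB lee_fin.
by rewrite lee_fin.
Qed.

Context (D : set int) (c : R) (c01 : 0 <= c <= 1).
Let A : pred nat := fun k => k.+1%:Z \in D.
Hypothesis decay : forall n s, 0 <= s <= 1 ->
  `|digit_indicator_mean A n s - c| <= (7 / 8) ^+ n * 2.

(** [z] is the centred count inherited from the digits already peeled off. *)
Definition deviation n (z : R) (y : R) : R := z + (digit_count D y n)%:R - n%:R * c.

(* The image of (0, 1) under y |-> (p + p' y) / (q + q' y) is a cylinder of
   Lebesgue measure 1 / (q (q + q')), and s = q' / q is the state of the chain. *)
Lemma cylinder_deviation n (p p' q q' z r : R) :
  0 < q -> 0 <= q' <= q -> `|p * q' - p' * q| = 1 -> 0 < r ->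
  outer_le [set (p + p' * y) / (q + q' * y) | y in
             [set y | [/\ irrational y, 0 < y < 1 & r <= `|deviation n z y|]]]
    ((q * (q + q'))^-1 * (moment_bound A c n (q' / q) z / r ^+ 2)).
Proof.
elim: n p p' q q' z => [|n IH] p p' q q' z q0 /andP[q'0 q'q] det r0.
  have qq0 : 0 < q * (q + q') by apply: mulr_gt0 => //; lra.
  rewrite /moment_bound /drift big_geq// addr0 mulr0 addr0.
  (* With no digit left the deviation is [z]: either the set is empty, or z^2/r^2 >= 1 and the whole
     cylinder is affordable. *)
  have [rz|zr] := leP r `|z|; last first.
    have v0 : 0 <= (q * (q + q'))^-1 * (z ^+ 2 / r ^+ 2).
      by apply: mulr_ge0; [rewrite invr_ge0 ltW|apply: divr_ge0; exact: sqr_ge0].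
    apply: (@outer_le_itv _ 0 0); rewrite ?subrr//.
    move=> x [y [_ _ ry] _]; move: ry; rewrite /deviation mul0r subr0 addr0.
    by rewrite leNgt zr.
  have w1 : 1 <= z ^+ 2 / r ^+ 2.
    rewrite ler_pdivlMr ?exprn_gt0// mul1r -[leRHS]ger0_norm ?sqr_ge0// normrX.
    by apply: lerXn2r => //; rewrite nnegrE ltW.
  have w2 : (q * (q + q'))^-1 <= (q * (q + q'))^-1 * (z ^+ 2 / r ^+ 2).
    by rewrite ler_peMr// invr_ge0 ltW.
  have w0 : 0 <= (q * (q + q'))^-1 by rewrite invr_ge0 ltW.
  (* The image differs from its endpoint p/q by the determinant times [t]; the sign of the
     determinant decides on which side of p/q the cylinder lies. *)
  have phiE y : 0 < y < 1 -> exists2 t : R, 0 <= t <= (q * (q + q'))^-1 &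
      (p + p' * y) / (q + q' * y) = p / q - (p * q' - p' * q) * t.
    move=> /andP[y0 y1]; have d0 : 0 < q + q' * y.
      by have := mulr_ge0 q'0 (ltW y0); lra.
    exists (y / (q * (q + q' * y))).
      apply/andP; split.
        by rewrite divr_ge0// ?mulr_ge0//; exact: ltW.
      rewrite ler_pdivrMr ?mulr_gt0// mulrC ler_pdivlMr//.
      rewrite mulrCA ler_pM2l//; have := mulr_ge0 q'0 (ltW y0).
      have : y * q <= 1 * q by rewrite ler_wpM2r// ltW.
      have : q' * y <= q' by rewrite ler_piMr// ltW.
      nra.
    by field; rewrite !gt_eqF.
  move/eqP: det; rewrite eqr_norml ler01 andbT => /orP[] /eqP det.
    apply: (@outer_le_itv _ (p / q - (q * (q + q'))^-1) (p / q)); last 2 first.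
    - by apply: le_trans w2; lra.
    - exact: le_trans w2.
    move=> _ [y [_ y01 _] <-]; have [t /andP[t0 t1] ->] := phiE y y01.
    by rewrite det; apply/andP; split; lra.
  apply: (@outer_le_itv _ (p / q) (p / q + (q * (q + q'))^-1)); last 2 first.
  - by apply: le_trans w2; lra.
  - exact: le_trans w2.
  move=> _ [y [_ y01 _] <-]; have [t /andP[t0 t1] ->] := phiE y y01.
  by rewrite det; apply/andP; split; lra.
set s := q' / q.
have s0 : 0 <= s by rewrite divr_ge0// ltW.
pose qk k := q * k.+1%:R + q'.
have qk1 k : q <= qk k.
  rewrite /qk; have := ler_wpM2l (ltW q0) (@natS_ge1 R k); lra.
have qk0 k : 0 < qk k by apply: lt_le_trans (qk1 k).
have r20 : 0 < r ^+ 2 by rewrite exprn_gt0.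
have w0 : 0 <= (q * (q + q'))^-1 by rewrite invr_ge0 mulr_ge0//; lra.
(* Putting y = 1/(k+1+y') into the Möbius map gives the recurrence of convergents: (p, p') becomes
   (p(k+1)+p', p), likewise for q, and the determinant changes sign. *)
apply: (@outer_le_bigcup _
  (fun k => [set (p * k.+1%:R + p' + p * y) / (qk k + q * y) | y in
     [set y | [/\ irrational y, 0 < y < 1 &
        r <= `|deviation n (z + ((A k)%:R - c)) y|]]])
  (fun k => (q * (q + q'))^-1 * (digit_prob s k *
     moment_bound A c n (next_state s k) (z + ((A k)%:R - c)) / r ^+ 2))).
- move=> _ [y [iy y01 ry] <-].
  have [k [y' [iy' y'01 yE cE]]] := first_digit iy y01.
  exists k => //; exists y'; first split => //.
    move: ry; rewrite /deviation cE natrD -natr1 -/(A k).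
    by congr (_ <= `|_|); ring.
  rewrite yE /qk; have k1 := @natS_ge1 R k.
  move: (k.+1%:R : R) k1 => x x1; case/andP: y'01 => y'0 y'1.
  have xy0 : 0 < x + y' by lra.
  have := mulr_gt0 q0 xy0 => qxy0.
  by field; do ?[apply/andP; split]; apply: lt0r_neq0; lra.
- move=> k; apply: mulr_ge0 => //; apply: divr_ge0; last exact: ltW.
  by rewrite mulr_ge0 ?digit_prob_ge0// moment_bound_ge0.
- move=> k; have := IH (p * k.+1%:R + p') p (qk k) q (z + ((A k)%:R - c)).
  have -> : q / qk k = next_state s k.
    rewrite /next_state /s /qk; have k1 := @natS_ge1 R k.
    have := qk0 k; rewrite /qk; move: (k.+1%:R : R) k1 => x x1 h.
    by field; do ?[apply/andP; split]; apply: lt0r_neq0; lra.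
  (* The ratio of lengths of the subcylinder and the cylinder is the transition probability. *)
  have -> : (qk k * (qk k + q))^-1 = (q * (q + q'))^-1 * digit_prob s k.
    rewrite digit_probE// /s /qk -[k.+2%:R]natr1; have k1 := @natS_ge1 R k.
    have := qk0 k; rewrite /qk; move: (k.+1%:R : R) k1 => x x1 h.
    by field; do ?[apply/andP; split]; apply: lt0r_neq0; lra.
  rewrite -!mulrA; apply => //; first by rewrite (ltW q0) qk1.
  have -> : (p * k.+1%:R + p') * q - p * qk k = - (p * q' - p' * q).
    by rewrite /qk; ring.
  by rewrite normrN.
- move=> N; rewrite -mulr_sumr ler_wpM2l// -mulr_suml ler_wpM2r ?invr_ge0 ?(ltW r20)//.
  exact: (moment_bound_step c01 decay).
Qed.

End CylinderCover.

(** * Borel-Cantelli along the squares *)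

Section AlmostEverywhere.
Context {R : realType}.
Local Notation mu := (@lebesgue_measure R).

Lemma square_interval (n : nat) : (0 < n)%N ->
  exists N, (N.+1 ^ 2 <= n < N.+2 ^ 2)%N.
Proof.
elim: n => // -[|n] IH _; first by exists 0%N.
have [//|N /andP[h1 h2]] := IH.
have [h|h] := ltnP n.+2 (N.+2 ^ 2); first by exists N; rewrite (leq_trans h1).
by exists N.+1; rewrite h (leq_ltn_trans h2)// ltn_sqr.
Qed.

(* Convergence along the squares suffices since consecutive squares n < m
   satisfy m / n --> 1. *)
Lemma cvg_mean_squares (S : nat -> nat) (c : R) : 0 <= c <= 1 ->
  (forall m n, (m <= n)%N -> (S m <= S n <= S m + (n - m))%N) ->
  (forall j : nat, \forall N \near \oo,
     `|(S (N.+1 ^ 2)%N)%:R - (N.+1 ^ 2)%:R * c| < (N.+1 ^ 2)%:R / j.+1%:R) ->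
  (S n)%:R / n%:R @[n --> \oo] --> c.
Proof.
move=> /andP[c0 c1] Sinc Ssq; apply/cvgrPdist_le => e e0.
(* Half of [e] pays for the deviation at the preceding square, the other half for the at most
   [2 * N.+1] digits after it. *)
have [j _ /(_ j (leqnn j)) je] : \forall j \near \oo, `|0 - harmonic j| <= e / 2 :> R.
  by move/cvgrPdist_le : (@cvg_harmonic R); apply; lra.
rewrite sub0r normrN gtr0_norm ?harmonic_gt0// in je.
have [N1 _ hN1] := Ssq j.
have [N2 _ hN2] : \forall N \near \oo, `|0 - harmonic N| <= e / 4 :> R.
  by move/cvgrPdist_le : (@cvg_harmonic R); apply; lra.
exists ((maxn N1 N2).+2 ^ 2)%N => //= n hn.
have n0 : (0 < n)%N by apply: leq_trans hn; rewrite expn_gt0.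
have [N /andP[Nn nN]] := square_interval n0.
have NN : (maxn N1 N2 <= N)%N.
  by have := leq_ltn_trans hn nN; rewrite ltn_sqr !ltnS => /ltnW.
have {}hN1 := hN1 N (leq_trans (leq_maxl _ _) NN).
have := hN2 N (leq_trans (leq_maxr _ _) NN).
rewrite /= sub0r normrN gtr0_norm ?harmonic_gt0// /harmonic/= => {}hN2.
have /andP[S1 S2] := Sinc _ _ Nn.
have hd : (n - N.+1 ^ 2 <= 2 * N.+1)%N.
  rewrite leq_subLR -ltnS (leq_trans nN)//.
  by rewrite -[N.+2]addn1 sqrnD exp1n muln1 addnAC addn1.
move: S1 S2 hd Nn; rewrite -!(ler_nat R) natrD natrM => S1 S2 hd Nn.
rewrite natrB in hd S2; last by rewrite -(ler_nat R).
have y1 : 1 <= N.+1%:R :> R by exact: natS_ge1.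
have NE : (N.+1 ^ 2)%:R = N.+1%:R ^+ 2 :> R by rewrite natrX.
rewrite NE in S1 S2 hd Nn hN1.
move: hN1; rewrite ltr_norml => /andP[g1 g2].
have n0' : 0 < n%:R :> R by rewrite ltr0n.
have -> : c - (S n)%:R / n%:R = (n%:R * c - (S n)%:R) / n%:R.
  by field; rewrite gt_eqF.
rewrite normrM [X in _ * X]ger0_norm ?invr_ge0 ?ler0n// ler_pdivrMr//.
have h1 : 2 * N.+1%:R <= e / 2 * N.+1%:R ^+ 2.
  rewrite expr2 mulrA ler_wpM2r ?ler0n//.
  rewrite -ler_pdivrMr; last lra.
  by apply: le_trans (ler_wpM2l (ler0n R 2) hN2) _; lra.
have h2 : N.+1%:R ^+ 2 / j.+1%:R <= e / 2 * N.+1%:R ^+ 2.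
  by rewrite mulrC ler_wpM2r ?sqr_ge0.
have h3 : e * N.+1%:R ^+ 2 <= e * n%:R by rewrite ler_wpM2l// ltW.
have h4 : N.+1%:R ^+ 2 * c <= n%:R * c by rewrite ler_wpM2r.
have h5 : (n%:R - N.+1%:R ^+ 2) * c <= n%:R - N.+1%:R ^+ 2.
  by rewrite ler_piMr// subr_ge0.
rewrite ler_norml.
move: h1 h2 h3 h4 h5 S1 S2 hd g1 g2.
move: (N.+1%:R : R) (n%:R : R) ((S n)%:R : R) => y x u.
move: ((S _)%:R : R) (j.+1%:R^-1) => v w *.
by apply/andP; split; lra.
Qed.

Lemma digit_count_increment D (x : R) m n : (m <= n)%N ->
  (digit_count D x m <= digit_count D x n <= digit_count D x m + (n - m))%N.
Proof.
move=> mn.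
have e : iota 1 n = iota 1 m ++ iota (1 + m) (n - m) by rewrite -iotaD subnKC.
rewrite /digit_count e count_cat leq_addr/=.
by rewrite leq_add2l (leq_trans (count_size _ _))// size_iota.
Qed.

Lemma inv_sq_sum_le N : \sum_(0 <= k < N) (k.+1%:R ^+ 2)^-1 <= 2 :> R.
Proof.
apply: (@le_trans _ _ (\sum_(0 <= k < N) 2 * ((k.+1%:R)^-1 - (k.+2%:R)^-1))).
  apply: ler_sum_nat => k _.
  have -> : k.+2%:R = k.+1%:R + 1 :> R by rewrite natr1.
  have := @natS_ge1 R k; move: (k.+1%:R : R) => x x1.
  have -> : 2 * (x^-1 - (x + 1)^-1) = 2 / (x * (x + 1)).
    by field; apply/andP; split; apply: lt0r_neq0; lra.
  rewrite ler_pdivlMr; last by apply: mulr_gt0; lra.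
  by rewrite mulrC ler_pdivrMr ?exprn_gt0//; [rewrite expr2; nra | lra].
rewrite -mulr_sumr (@telescope_sumr_eq _ _ _ (fun k => - (k.+1%:R)^-1))//; last first.
  by move=> k _; rewrite opprK addrC.
by rewrite opprK addrC invr1 ler_piMr// gerBl invr_ge0.
Qed.

Lemma digit_frequency (D : set int) : exists c : R,
  \sum_(0 <= k < N) (k.+1%:Z \in D)%:R * gauss_weight k @[N --> \oo] --> c * ln 2 /\
  {ae mu, forall x : R, cf_digit_freq D x n @[n --> \oo] --> c}.
Proof.
have [c [c01 cE decay]] := @digit_indicator_mean_decay R (fun k => k.+1%:Z \in D).
exists c; split => //.
(* [i] codes an integer part and a tolerance 1/(j+1), so that countably many null sets suffice. *)
pose e (i : nat) : int * nat := odflt (0, 0%N) (unpickle i).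
pose bad i N := [set x : R | [/\ irrational x, Num.floor x = (e i).1 &
  (N.+1 ^ 2)%:R / (e i).2.+1%:R <=
  `|(digit_count D x (N.+1 ^ 2))%:R - (N.+1 ^ 2)%:R * c| ]].
have cover i N :
    (* 545 = 16 ^ 2 + 289 *)
    outer_le (bad i N) (545 * (e i).2.+1%:R ^+ 2 * (N.+1%:R ^+ 2)^-1).
  set a := (e i).1; set j := (e i).2.+1%:R.
  have j1 : 1 <= j :> R by exact: natS_ge1.
  have N1 : 1 <= N.+1%:R :> R by exact: natS_ge1.
  (* The map y |-> a + y is the cylinder of length 1 and state 0. *)
  have [|||M [mM SM muM]] := @cylinder_deviation R D c c01 decay (N.+1 ^ 2) a%:~R 1 1 0 0
    ((N.+1 ^ 2)%:R / j) ltr01.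
  - by rewrite lexx ler01.
  - by rewrite mulr0 mul1r sub0r normrN normr1.
  - by rewrite divr_gt0// ?ltr0n ?expn_gt0//; lra.
  exists M; split => //.
    move=> x [ix xa hx]; apply: SM; exists (x - a%:~R).
      split; [exact: irrationalBz|by rewrite /a -xa; exact: irrational_fracP|].
      by rewrite /deviation add0r digit_count_subz.
    by rewrite mul0r addr0 divr1 mul1r addrC subrK.
  apply: le_trans muM _; rewrite lee_fin addr0 mulr1 invr1 mul1r mul0r.
  rewrite /moment_bound add0r.
  have : drift (fun k => k.+1%:Z \in D) c (N.+1 ^ 2) 0 ^+ 2 <= 16 ^+ 2.
    rewrite -[leLHS]ger0_norm ?sqr_ge0// normrX.
    apply: lerXn2r; rewrite ?nnegrE//.
    by apply: (drift_bound decay); rewrite lexx ler01.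
  move: (drift _ _ _ _) => d hd; rewrite natrX.
  move: (N.+1%:R : R) N1 => y y1.
  have -> : 545 * j ^+ 2 * (y ^+ 2)^-1 = 545 * y ^+ 2 / (y ^+ 2 / j) ^+ 2.
    by field; apply/andP; split; apply: lt0r_neq0; lra.
  rewrite ler_wpM2r ?invr_ge0 ?sqr_ge0//.
  have : 1 <= y ^+ 2 by rewrite expr2; nra.
  lra.
have null i : mu.-negligible (lim_sup_set (bad i)).
  have j0 : 0 <= 545 * (e i).2.+1%:R ^+ 2 :> R.
    exact: mulr_ge0 (ler0n R 545) (sqr_ge0 _).
  have [M hM] := choice (cover i).
  have mM N : measurable (M N) by have [] := hM N.
  have sM : lim_sup_set (bad i) `<=` lim_sup_set M.
    move=> x hx N _; have [N' NN' xN'] := hx N I; exists N' => //.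
    by have [_ + _] := hM N'; apply.
  have mS : measurable (lim_sup_set M).
    apply: bigcap_measurable => // N _; apply: bigcup_measurable => k _; exact: mM.
  exists (lim_sup_set M); split => //.
  apply: lim_sup_set_cvg0 => //.
  apply: (@le_lt_trans _ _ (\sum_(N <oo)
      (545 * (e i).2.+1%:R ^+ 2 * (N.+1%:R ^+ 2)^-1)%:E)%E).
    by apply: lee_nneseries => // N _; have [] := hM N.
  apply: (@le_lt_trans _ _ (545 * (e i).2.+1%:R ^+ 2 * 2)%:E); last exact: ltry.
  apply: lime_le.
    apply: is_cvg_nneseries => N _ _.
    by rewrite lee_fin; apply: mulr_ge0; [exact: j0|rewrite invr_ge0 sqr_ge0].
  apply: nearW => N; rewrite sumEFin lee_fin -mulr_sumr.
  by apply: (ler_wpM2l j0); exact: inv_sq_sum_le.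
have nullQ : mu.-negligible (@rational R).
  exists (range ratr); split => //; last exact: lebesgue_measure_rat.
  apply: countable_measurable; first by move=> *; exact: measurable_set1.
  exact: sub_countable (card_image_le _ _) (countableP [set: rat]).
apply: (negligibleS (mu := mu) _ (negligibleU nullQ (negligible_bigcup null))).
move=> x /= xn; have [qx|ix] := pselect (rational x); [by left|right].
apply: contrapT => hx; apply: xn.
apply: cvg_mean_squares => //; first by move=> m n; exact: digit_count_increment.
move=> j; apply: contrapT => hj; apply: hx.
exists (pickle (Num.floor x, j)) => // N _.
apply: contrapT => hN; apply: hj; exists N => // n /= Nn.
rewrite ltNge; apply/negP => h; apply: hN; exists n => //.
by rewrite /bad /e /= pickleK.
Qed.

End AlmostEverywhere.

(** * The logarithmic Euler product by sieving *)

Section EulerProduct.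
Context {R : realType}.
Implicit Types (m n N P q : nat).

(* For m > 0, inv_pow m 0 = 0, so that sums may start at 0. *)
Definition inv_pow m n : R := (n%:R ^+ m)^-1.

Lemma inv_pow_ge0 m n : 0 <= inv_pow m n.
Proof. by rewrite invr_ge0 exprn_ge0. Qed.

Lemma inv_pow0 m : (0 < m)%N -> inv_pow m 0 = 0.
Proof. by move=> m0; rewrite /inv_pow expr0n gtn_eqF// invr0. Qed.

Lemma inv_powM m q n : inv_pow m (q * n) = inv_pow m q * inv_pow m n.
Proof. by rewrite /inv_pow natrM exprMn invfM. Qed.

Lemma inv_pow_lt1 m n : (0 < m)%N -> (1 < n)%N -> inv_pow m n < 1.
Proof.
by move=> m0 n1; rewrite invf_lt1 ?exprn_gt0 ?ltr0n ?exprn_egt1 ?ltr1n -?lt0n// ltnW.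
Qed.

Lemma nondecreasing_cond_sum (b : pred nat) m :
  nondecreasing_seq (fun N => \sum_(0 <= n < N | b n) inv_pow m n).
Proof.
move=> N M NM; rewrite (big_cat_nat (leq0n N) NM)/= lerDl.
by apply: sumr_ge0 => n _; exact: inv_pow_ge0.
Qed.

Lemma cond_sum_le m (b : pred nat) N : (1 < m)%N ->
  \sum_(0 <= n < N | b n) inv_pow m n <= 2.
Proof.
move=> m1; apply: (@le_trans _ _ (\sum_(0 <= n < N) inv_pow m n)).
  rewrite [leRHS](bigID b)/= lerDl; apply: sumr_ge0 => n _; exact: inv_pow_ge0.
case: N => [|N]; first by rewrite big_geq.
rewrite big_nat_recl//= inv_pow0 ?(ltnW m1)// add0r.
apply: le_trans (inv_sq_sum_le N); apply: ler_sum_nat => n _.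
by rewrite lef_pV2 ?posrE ?exprn_gt0// ler_weXn2l// ler1n.
Qed.

Lemma is_cvg_cond_sum m (b : pred nat) : (1 < m)%N ->
  cvgn (fun N => \sum_(0 <= n < N | b n) inv_pow m n).
Proof.
move=> m1; apply: nondecreasing_is_cvgn; first exact: nondecreasing_cond_sum.
by exists 2 => _ [N _ <-]; exact: cond_sum_le.
Qed.

Lemma cvg_subseq (T : topologicalType) (u : nat -> T) (l : T) (f : nat -> nat) :
  (forall n, (n <= f n)%N) -> u n @[n --> \oo] --> l -> u (f n) @[n --> \oo] --> l.
Proof.
move=> fn ul; apply: (cvg_comp f u _ ul) => A [N _ h].
by exists N => // n /= Nn; apply: h; exact: leq_trans (fn n).
Qed.

Definition sifted P n := all (fun p => prime p ==> ~~ (p %| n)%N) (iota 0 P).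

Lemma siftedS P n : sifted P.+1 n = sifted P n && (prime P ==> ~~ (P %| n)%N).
Proof. by rewrite /sifted -addn1 iotaD all_cat /= andbT. Qed.

Lemma siftedM P n : prime P -> sifted P (P * n) = sifted P n.
Proof.
move=> pP; apply: eq_in_all => p; rewrite mem_iota => /andP[_ pltP].
case pp : (prime p) => //=; rewrite Euclid_dvdM// dvdn_prime2//.
by rewrite (ltn_eqF pltP).
Qed.

Lemma sum_multiples (f : nat -> R) q M : (0 < q)%N ->
  \sum_(0 <= n < q * M | (q %| n)%N) f n = \sum_(0 <= j < M) f (q * j)%N.
Proof.
move=> q0; elim: M => [|M IH]; first by rewrite muln0 !big_geq.
rewrite big_nat_recr//= -IH mulnSr.
rewrite (big_cat_nat (leq0n (q * M)) (leq_addr _ _))/=; congr (_ + _).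
rewrite big_ltn_cond; last by rewrite -[X in (X < _)%N]addn0 ltn_add2l.
rewrite dvdn_mulr// big_nat_cond big1 ?addr0// => n /andP[/andP[h1 h2] h3].
case/dvdnP: h3 h1 h2 => j ->; rewrite [(j * q)%N]mulnC ltn_pmul2l// -mulnSr ltn_pmul2l//.
by rewrite ltnS => h1 h2; have := leq_trans h1 h2; rewrite ltnn.
Qed.

(* Sieving out the multiples of a new prime P removes the fraction 1 / P^m of
   the sum. *)
Lemma cvg_sifted_sum m (z : R) P : (1 < m)%N ->
  \sum_(0 <= n < N) inv_pow m n @[N --> \oo] --> z ->
  \sum_(0 <= n < N | sifted P n) inv_pow m n @[N --> \oo] -->
    z * \prod_(0 <= p < P | prime p) (1 - inv_pow m p).
Proof.
move=> m1 cz; elim: P => [|P IH]; first by rewrite big_geq// mulr1.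
rewrite big_mkcond big_nat_recr//= -big_mkcond/= mulrA.
case: ifPn => pP; last first.
  rewrite mulr1; under eq_fun do under eq_bigl do rewrite siftedS (negPf pP) andbT.
  exact: IH.
have P0 : (0 < P)%N by exact: prime_gt0.
move: IH; set l := z * _ => IH.
have /cvg_ex[/= l' cl'] := @is_cvg_cond_sum m (sifted P.+1) m1.
(* The limit exists by boundedness, so it may be computed along cutoffs P * M, where the multiples
   of P correspond exactly to the indices below M. *)
have sub (M : nat) : (M <= P * M)%N by rewrite leq_pmull.
have c1 := cvg_subseq sub cl'.
have c2 : \sum_(0 <= n < P * M | sifted P n) inv_pow m n -
    inv_pow m P * \sum_(0 <= n < M | sifted P n) inv_pow m n @[M --> \oo] -->
    l - inv_pow m P * l.
  by apply: cvgB; [exact: cvg_subseq IH|exact: cvgZr].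
suff e : l' = l * (1 - inv_pow m P) by rewrite -e.
rewrite mulrBr mulr1 [l * _]mulrC -(cvg_lim _ c1)// -(cvg_lim _ c2)//.
congr (limn _); apply/funext => M.
rewrite [X in _ = X - _](bigID (fun n => (P %| n)%N))/= addrC.
have -> : inv_pow m P * \sum_(0 <= n < M | sifted P n) inv_pow m n =
    \sum_(0 <= n < P * M | sifted P n && (P %| n)%N) inv_pow m n.
  rewrite mulr_sumr.
  under [RHS]eq_bigl do rewrite andbC.
  rewrite big_mkcondr/= sum_multiples// big_mkcond/=; apply: eq_bigr => n _.
  by rewrite siftedM// inv_powM.
rewrite addrK; apply: eq_bigl => n; by rewrite siftedS pP.
Qed.

Lemma sifted1 P : sifted P 1.
Proof.
apply/allP => p _; apply/implyP => pp; rewrite dvdn1.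
by apply: contraTneq pp => ->.
Qed.

(** [z * F P] sums over the n without prime factor below P. It is at least the term n = 1, and
    exceeds it by at most the tail from P on, because every n with 1 < n < P is sieved out. Hence it
    tends to 1, and logarithms give the claim. *)
Lemma euler_product m (z : R) : (1 < m)%N ->
  \sum_(0 <= n < N) inv_pow m n @[N --> \oo] --> z ->
  \sum_(0 <= p < P | prime p) - ln (1 - inv_pow m p) @[P --> \oo] --> ln z.
Proof.
move=> m1 cz; have m0 := ltnW m1.
pose F P : R := \prod_(0 <= p < P | prime p) (1 - inv_pow m p).
have cs P := @cvg_sifted_sum m z P m1 cz.
have lower P : 1 <= z * F P.
  apply: (cvgr_to_ge (cs P)).
  near=> N; have N1 : (1 < N)%N by near: N; exact: nbhs_infty_ge.
  rewrite big_mkcond (bigD1_seq 1%N) ?iota_uniq ?mem_index_iota//= sifted1.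
  rewrite {1}/inv_pow expr1n invr1 lerDl; apply: sumr_ge0 => n _.
  by case: ifP => // _; exact: inv_pow_ge0.
have upper P : z * F P <= 1 + (z - \sum_(0 <= n < P) inv_pow m n).
  have c : 1 + (\sum_(0 <= n < N) inv_pow m n - \sum_(0 <= n < P) inv_pow m n)
      @[N --> \oo] --> 1 + (z - \sum_(0 <= n < P) inv_pow m n).
    by apply: cvgD; [exact: cvg_cst|apply: cvgB => //; exact: cvg_cst].
  apply: (ler_cvg_to (cs P) c); near=> N.
  have PN : (P <= N)%N by near: N; exact: nbhs_infty_ge.
  rewrite [in leRHS](big_cat_nat (leq0n P) PN)/= [in leRHS]addrC addrK.
  rewrite (big_cat_nat (leq0n P) PN)/=; apply: lerD; last first.
    rewrite [leRHS](bigID (sifted P))/= lerDl; apply: sumr_ge0 => n _.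
    exact: inv_pow_ge0.
  have h n : (0 <= n < P)%N && sifted P n -> inv_pow m n <= (n == 1%N)%:R.
    move=> /andP[/andP[_ nP] /allP sn].
    case: n nP sn => [|[|n]] nP sn; first by rewrite inv_pow0.
      by rewrite /inv_pow expr1n invr1.
    have pP : pdiv n.+2 \in iota 0 P.
      by rewrite mem_iota /= add0n (leq_ltn_trans _ nP)// pdiv_leq.
    by have /implyP := sn _ pP; rewrite pdiv_prime// pdiv_dvd => /(_ isT).
  rewrite big_nat_cond; apply: le_trans (ler_sum _ h) _.
  apply: (@le_trans _ _ (\sum_(0 <= n < P) (n == 1%N)%:R)).
    rewrite -big_nat_cond [leRHS](bigID (sifted P))/= lerDl.
    by apply: sumr_ge0.
  rewrite -natr_sum -[1]/(1%:R) ler_nat -big_mkcond/= sum1_count.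
  by rewrite (@count_uniq_mem _ (index_iota 0 P) 1%N) ?iota_uniq// leq_b1.
have z0 : 0 < z.
  have := lower 0%N; rewrite /F big_geq// mulr1; exact: lt_le_trans.
have F0 P : 0 < F P.
  by rewrite -(pmulr_rgt0 _ z0); apply: lt_le_trans (lower P).
have cF : z * F P @[P --> \oo] --> (1 : R).
  have c : 1 + (z - \sum_(0 <= n < P) inv_pow m n) @[P --> \oo] --> 1 + (z - z).
    by apply: cvgD; [exact: cvg_cst|apply: cvgB => //; exact: cvg_cst].
  rewrite subrr addr0 in c.
  apply: (squeeze_cvgr _ (cvg_cst (1 : R)) c).
  by apply: nearW => P; rewrite lower upper.
have E P : \sum_(0 <= p < P | prime p) - ln (1 - inv_pow m p) = ln z - ln (z * F P).
  rewrite lnM ?posrE// opprD addrA subrr add0r sumrN; congr (- _).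
  rewrite /F; elim: P => [|P IH]; first by rewrite !big_geq// ln1.
  rewrite big_mkcond big_nat_recr//= -big_mkcond IH.
  rewrite [in RHS]big_mkcond [in RHS]big_nat_recr//= -[in RHS]big_mkcond/=.
  case: ifPn => pP; last by rewrite addr0 mulr1.
  rewrite lnM ?posrE//; first exact: F0.
  by rewrite subr_gt0 inv_pow_lt1// prime_gt1.
under eq_fun do rewrite E.
have h : ln z - ln (z * F P) @[P --> \oo] --> ln z - ln 1.
  apply: cvgB; first exact: cvg_cst.
  by apply: (continuous_cvg _ _ cF); exact: continuous_ln.
by rewrite ln1 subr0 in h.
Unshelve. all: by end_near.
Qed.

Lemma cvg_riemann_zeta m : (1 < m)%N ->
  \sum_(0 <= n < N) inv_pow m n @[N --> \oo] --> riemann_zeta (m%:R : R).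
Proof.
move=> m1; have /cvg_ex[/= z cz] := @is_cvg_cond_sum m xpredT m1.
suff <- : z = riemann_zeta (m%:R : R) by [].
rewrite /riemann_zeta; apply/esym/cvg_lim => //.
have -> : series (fun n => n.+1%:R `^ (- m%:R)) =
    (fun N => \sum_(0 <= n < N.+1) inv_pow m n).
  apply/funext => N; rewrite big_nat_recl//= inv_pow0 ?(ltnW m1)// add0r.
  by apply: eq_bigr => n _; rewrite powRN powR_mulrn.
exact: cvg_subseq cz.
Qed.

End EulerProduct.

(** * The value of zeta at 2 *)

Section Basel.
Context {R : realType}.
Implicit Types (x : R) (i j n : nat).

Lemma sin_le x : 0 < x -> sin x <= x.
Proof.
move=> x0; have d y : y \in `]0, x[ -> is_derive y 1 (fun t : R => t - sin t) (1 - cos y).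
  by move=> _; apply: is_deriveB.
have [|c _] := @MVT _ _ _ 0 x x0 d.
  apply: derivable_within_continuous => y _.
  by apply: derivableB => //; exact: derivable_sin.
rewrite sin0 !subr0 => e; rewrite -subr_ge0 e mulr_ge0 ?(ltW x0)//.
Qed.

Lemma le_tan x : 0 < x < pi / 2 -> x <= tan x.
Proof.
move=> /andP[x0 x1].
have cosy y : 0 <= y <= x -> 0 < cos y.
  move=> /andP[y0 yx]; apply: cos_gt0_pihalf; apply/andP; split; lra.
have d y : 0 <= y <= x -> is_derive y 1 (fun t : R => tan t - t) ((cos y)^-2 - 1).
  move=> /cosy cy; apply: is_deriveB; apply: is_derive_tan; exact: lt0r_neq0.
have d' y : y \in `]0, x[ -> is_derive y 1 (fun t : R => tan t - t) ((cos y)^-2 - 1).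
  by rewrite in_itv/= => /andP[y0 yx]; apply: d; rewrite !ltW.
have [|c] := @MVT _ _ _ 0 x x0 d'.
  apply: derivable_within_continuous => y; rewrite in_itv/= => y01.
  by have [] := d y y01.
rewrite in_itv/= tan0 !subr0 => /andP[c0 cx] e.
rewrite -subr_ge0 e mulr_ge0 ?(ltW x0)// subr_ge0.
have c1 : 0 < cos c by apply: cosy; rewrite !ltW.
by rewrite invf_ge1 ?exprn_gt0// exprn_ile1 ?cos_le1// ltW.
Qed.

Lemma inv_sin_sq_half x : sin x != 0 -> cos x != 0 ->
  (sin x ^+ 2)^-1 + (cos x ^+ 2)^-1 = 4 * (sin (x *+ 2) ^+ 2)^-1.
Proof.
move=> s0 c0; rewrite sin_mulr2n -mulr_natl.
have -> : (sin x ^+ 2)^-1 + (cos x ^+ 2)^-1 =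
    (cos x ^+ 2 + sin x ^+ 2) / (sin x ^+ 2 * cos x ^+ 2).
  by field; rewrite s0 c0.
by rewrite cos2Dsin2; field; rewrite s0 c0.
Qed.

Definition odd_angle j i : R := (2 * i%:R + 1) * pi / (4 * 2 ^+ j).

Lemma odd_angle_bounds j i : (i < 2 ^ j)%N -> 0 < odd_angle j i < pi / 2.
Proof.
move=> ij; have p0 := @pi_gt0 R.
have j0 : 0 < 2 ^+ j :> R by rewrite exprn_gt0.
have h : i%:R + 1 <= 2 ^+ j :> R by rewrite natr1 -natrX ler_nat.
have i0 : 0 <= i%:R :> R by [].
rewrite /odd_angle; move: (i%:R : R) h i0 => y h y0.
have y1 : 0 < 2 * y + 1 by lra.
rewrite divr_gt0 ?mulr_gt0//=.
rewrite ltr_pdivrMr ?mulr_gt0//.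
have -> : pi / 2 * (4 * 2 ^+ j) = (2 * 2 ^+ j) * pi :> R by field.
by rewrite ltr_pM2r//; lra.
Qed.

(* Hofbauer's telescoping of 1 / sin^2 (pi / 4) = 2 by angle halving. *)
Lemma sum_inv_sin_sq j :
  \sum_(0 <= i < 2 ^ j) (sin (odd_angle j i) ^+ 2)^-1 = 2 * 4 ^+ j :> R.
Proof.
elim: j => [|j IH].
  rewrite expn0 big_nat1 /odd_angle mulr0 add0r mul1r expr0 !mulr1.
  have h := @cos_mulr2n R (pi / 4); have h2 := @cos2sin2 R (pi / 4).
  have e : (pi / 4) *+ 2 = pi / 2 :> R by rewrite -mulr_natl; field.
  move: h; rewrite e cos_pihalf h2 -mulr_natl => h.
  have -> : sin (pi / 4) ^+ 2 = 2^-1 :> R by lra.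
  by rewrite invrK.
have M2 : (2 ^ j.+1 = 2 ^ j + 2 ^ j)%N by rewrite expnS mul2n addnn.
rewrite M2 (big_cat_nat (leq0n _) (leq_addr (2 ^ j) (2 ^ j)))/=.
(* Reversing the upper half pairs each angle with its complement to pi/2, where the sine becomes a
   cosine. *)
rewrite -{2}[(2 ^ j)%N]add0n big_addn addnK [X in _ + X]big_nat_rev/= add0n -big_split/=.
rewrite exprS mulrCA -IH mulr_sumr.
rewrite !big_nat; apply: eq_bigr => i /andP[_ ij].
have /andP[a0 a1] := odd_angle_bounds ij.
have aE : odd_angle j i = odd_angle j.+1 i *+ 2.
  rewrite /odd_angle exprS -mulr_natl; field.
  by rewrite expf_neq0.
have -> : odd_angle j.+1 (2 ^ j - i.+1 + 2 ^ j) = pi / 2 - odd_angle j.+1 i.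
  rewrite /odd_angle natrD natrB// -natr1 natrX exprS; field.
  by rewrite expf_neq0.
have e2 : odd_angle j i = 2 * odd_angle j.+1 i by rewrite aE mulr_natl.
rewrite e2 in a0 a1; rewrite aE; set x := odd_angle j.+1 i in a0 a1 *.
rewrite sinB sin_pihalf cos_pihalf mul1r mul0r subr0.
apply: inv_sin_sq_half; apply: lt0r_neq0.
  by apply: sin_gt0_pihalf; apply/andP; split; lra.
by apply: cos_gt0_pihalf; apply/andP; split; lra.
Qed.

(** The left side is cot^2 x, so this is sin x <= x <= tan x. *)
Lemma inv_sq_bounds x : 0 < x < pi / 2 ->
  (sin x ^+ 2)^-1 - 1 <= (x ^+ 2)^-1 <= (sin x ^+ 2)^-1.
Proof.
move=> x01; have /andP[x0 x1] := x01; have s0 := sin_gt0_pihalf x01.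
have c0 : 0 < cos x by apply: cos_gt0_pihalf; apply/andP; split; lra.
apply/andP; split; last first.
  rewrite lef_pV2 ?posrE ?exprn_gt0//; apply: lerXn2r; rewrite ?nnegrE;
    [exact: ltW|exact: ltW|exact: sin_le].
have -> : (sin x ^+ 2)^-1 - 1 = (tan x ^+ 2)^-1.
  rewrite /tan.
  have -> : ((sin x / cos x) ^+ 2)^-1 = cos x ^+ 2 / sin x ^+ 2.
    by field; rewrite !gt_eqF.
  by rewrite cos2sin2; field; rewrite gt_eqF.
have t0 : 0 < tan x by rewrite divr_gt0.
rewrite lef_pV2 ?posrE ?exprn_gt0//; apply: lerXn2r; rewrite ?nnegrE ?(ltW x0) ?(ltW t0)//.
exact: le_tan.
Qed.

(** Replacing each 1/sin^2 by the inverse square of the angle costs at most 1 per term, so at most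
    2^j out of 2 * 4^j: a relative error of 1/(2 * 2^j). *)
Lemma sum_odd_inv_sq j :
  (pi : R) ^+ 2 / 8 * (1 - 2^-1 * (2 ^+ j)^-1) <=
  \sum_(0 <= i < 2 ^ j) ((2 * i%:R + 1) ^+ 2)^-1 <= (pi : R) ^+ 2 / 8.
Proof.
have p0 := @pi_gt0 R.
have j0 : 0 < 2 ^+ j :> R by rewrite exprn_gt0.
pose S := \sum_(0 <= i < 2 ^ j) (odd_angle j i ^+ 2)^-1 : R.
have -> : \sum_(0 <= i < 2 ^ j) ((2 * i%:R + 1) ^+ 2)^-1 =
    pi ^+ 2 / 16 * (2 ^+ j) ^- 2 * S :> R.
  rewrite /S mulr_sumr; apply: eq_bigr => i _; rewrite /odd_angle.
  have i0 : 0 <= i%:R :> R by [].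
  by field; do ?[apply/andP; split]; apply: lt0r_neq0; lra.
have b i : (0 <= i < 2 ^ j)%N -> (sin (odd_angle j i) ^+ 2)^-1 - 1 <=
    (odd_angle j i ^+ 2)^-1 <= (sin (odd_angle j i) ^+ 2)^-1.
  by move=> /andP[_ ij]; apply: inv_sq_bounds; exact: odd_angle_bounds.
have E : 4 ^+ j = (2 ^+ j) ^+ 2 :> R.
  by rewrite -exprM mulnC exprM; congr (_ ^+ _); rewrite expr2; ring.
have S1 : S <= 2 * (2 ^+ j) ^+ 2.
  rewrite -E -sum_inv_sin_sq; apply: ler_sum_nat => i ij.
  by have /andP[] := b i ij.
have S2 : 2 * (2 ^+ j) ^+ 2 - 2 ^+ j <= S.
  have card : \sum_(0 <= i < 2 ^ j) 1 = 2 ^+ j :> R.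
    by rewrite sumr_const_nat subn0 -natrX.
  rewrite -E -sum_inv_sin_sq -card -sumrB.
  by apply: ler_sum_nat => i ij; have /andP[] := b i ij.
have w0 : 0 <= pi ^+ 2 / 16 * (2 ^+ j) ^- 2 :> R.
  by rewrite mulr_ge0 ?divr_ge0 ?invr_ge0 ?sqr_ge0.
apply/andP; split.
  apply: le_trans (ler_wpM2l w0 S2).
  rewrite le_eqVlt; apply/orP; left; apply/eqP; field.
  by rewrite gt_eqF.
apply: le_trans (ler_wpM2l w0 S1) _.
rewrite le_eqVlt; apply/orP; left; apply/eqP; field.
by rewrite gt_eqF.
Qed.

Lemma sum_odd_reindex (f : nat -> R) n :
  \sum_(0 <= k < n.*2 | odd k) f k = \sum_(0 <= i < n) f i.*2.+1.
Proof.
elim: n => [|n IH]; first by rewrite !big_geq.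
rewrite doubleS [LHS]big_mkcond !big_nat_recr//= -[X in X + _ + _]big_mkcond IH.
by rewrite odd_double /= addr0.
Qed.

Theorem riemann_zeta2 : riemann_zeta (2 : R) = pi ^+ 2 / 6.
Proof.
have cz := @cvg_riemann_zeta R 2 isT.
(* Sieving by the only prime below 3 keeps the odd n, whose sum is therefore 3/4 of the zeta
   value. *)
have c3 := @cvg_sifted_sum R 2 _ 3 isT cz.
have sub j : (j <= (2 ^ j).*2)%N.
  by rewrite -addnn (leq_trans _ (leq_addr _ _))// ltnW// ltn_expl.
have c := cvg_subseq sub c3.
have E : (fun j => \sum_(0 <= n < (2 ^ j).*2 | sifted 3 n) inv_pow 2 n) =
    (fun j => \sum_(0 <= i < 2 ^ j) ((2 * i%:R + 1) ^+ 2)^-1 : R).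
  apply/funext => j; under eq_bigl => n.
    rewrite /sifted /= dvdn2 negbK andbT; over.
  rewrite sum_odd_reindex; apply: eq_bigr => i _.
  by rewrite /inv_pow -natr1 -mul2n natrM.
rewrite E in c.
have c1 : (\sum_(0 <= i < 2 ^ j) ((2 * i%:R + 1) ^+ 2)^-1 : R) @[j --> \oo] -->
    (pi ^+ 2 / 8 : R).
  have h : (pi : R) ^+ 2 / 8 * (1 - 2^-1 * (2 ^+ j)^-1) @[j --> \oo] -->
      (pi : R) ^+ 2 / 8 * (1 - 2^-1 * 0).
    apply: cvgZr; apply: cvgB; first exact: cvg_cst.
    apply: cvgZr; under eq_fun do rewrite -exprVn.
    by apply: cvg_expr; rewrite ger0_norm; lra.
  rewrite mulr0 subr0 mulr1 in h.
  apply: (squeeze_cvgr _ h (cvg_cst _)).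
  by apply: nearW => j; exact: sum_odd_inv_sq.
have : riemann_zeta (2 : R) * \prod_(0 <= p < 3 | prime p) (1 - inv_pow 2 p) =
    pi ^+ 2 / 8.
  by rewrite -(cvg_lim _ c)// -(cvg_lim _ c1).
rewrite big_mkcond !big_nat_recr//= big_geq// /inv_pow.
move: (riemann_zeta _) (pi ^+ 2) => z p.
by rewrite !mul1r; lra.
Qed.

End Basel.

(** * From prime power digits to the Euler product *)

Section PrimePowerDigits.
Context {R : realType} (k : nat) (k0 : (0 < k)%N).

Let prime_pow n := `[< exists2 p : nat, prime p & (n = p ^ k)%N >].

Lemma mem_prime_pow_minus1 n :
  (n.+1%:Z \in prime_pow_minus1 k) = prime_pow n.+2.
Proof.
have e (p : nat) : prime p -> (p%:Z ^+ k - 1 = n.+1%:Z) <-> (n.+2 = p ^ k)%N.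
  move=> pp; rewrite -[p%:Z]natz -natrX natz; have : (0 < p ^ k)%N by rewrite expn_gt0 prime_gt0.
  case: (p ^ k)%N => // q _; rewrite -[q.+1]addn1 PoszD addrK addn1.
  by split=> [[->]|[->]].
apply/idP/asboolP => [|[p pp np]].
  by rewrite inE => -[p pp /(e p pp)]; exists p.
by rewrite inE; exists p => //; exact/(e p pp).
Qed.

Let log_weight n : R := - ln (1 - inv_pow 2 n).

(** Between P^k and (P+1)^k - 1 the only k-th power is P^k, so the cutoff P^k on prime powers
    matches the cutoff P on primes. *)
Lemma sum_prime_pow P :
  \sum_(0 <= n < P ^ k | prime_pow n) log_weight n =
  \sum_(0 <= p < P | prime p) - ln (1 - inv_pow (2 * k) p).
Proof.
elim: P => [|P IH]; first by rewrite exp0n// !big_geq.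
have Pk : (P ^ k < P.+1 ^ k)%N by rewrite ltn_exp2r.
rewrite (big_cat_nat (leq0n _) (ltnW Pk))/= IH.
rewrite [RHS]big_mkcond big_nat_recr//= -[in RHS]big_mkcond; congr (_ + _).
rewrite big_mkcond big_ltn// big_nat big1 ?addr0; last first.
  move=> n /andP[h1 h2]; case: ifP => // /asboolP[p pp np].
  move: h1 h2; rewrite np !ltn_exp2r// ltnS => h1 h2.
  by have := leq_trans h1 h2; rewrite ltnn.
have -> : prime_pow (P ^ k) = prime P.
  apply/asboolP/idP => [[p pp /eqP]|pP]; last by exists P.
  by rewrite eqn_exp2r// => /eqP ->.
transitivity (if prime P then log_weight (P ^ k) else 0); first exact: addr0.
by case: ifP => // _; rewrite /log_weight /inv_pow mulnC exprM natrX.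
Qed.

Lemma prime_pow_digit_frequency :
  {ae @lebesgue_measure R, forall x : R,
     cf_digit_freq (prime_pow_minus1 k) x n @[n --> \oo]
       --> log2 (riemann_zeta (2 * k)%:R)}.
Proof.
have [c [cE freq]] := @digit_frequency R (prime_pow_minus1 k).
suff -> : log2 (riemann_zeta (2 * k)%:R) = c by [].
have k1 : (1 < 2 * k)%N by rewrite mul2n -addnn; case: k k0 => // j; rewrite addnS.
have ez := euler_product k1 (@cvg_riemann_zeta R _ k1).
have ln20 : ln 2 != 0 :> R by rewrite gt_eqF// ln_gt0// ltr1n.
apply: (mulIf ln20); rewrite /log2 divfK//.
(* Index n stands for the digit n+1, which is p^k - 1 exactly when n+2 = p^k; the two extra indices
   0 and 1 are not prime powers since k > 0. *)
have T N : \sum_(0 <= n < N.+2 | prime_pow n) log_weight n =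
    \sum_(0 <= n < N) (n.+1%:Z \in prime_pow_minus1 k)%:R * gauss_weight n.
  have np n : (n < 2)%N -> prime_pow n = false.
    move=> n2; apply/asboolP => -[p pp np].
    have : (2 ^ 1 <= p ^ k)%N.
      by rewrite expn1 (leq_trans (prime_gt1 pp))// -{1}[p]expn1 leq_pexp2l// prime_gt0.
    by rewrite -np leqNgt n2.
  rewrite big_mkcond !big_nat_recl//= !np// !add0r; apply: eq_bigr => n _.
  rewrite mem_prime_pow_minus1 gauss_weightE.
  by case: ifP; rewrite ?mul1r ?mul0r.
have c1 : \sum_(0 <= n < N | prime_pow n) log_weight n @[N --> \oo] --> c * ln 2.
  rewrite -(cvg_shiftn 2)/=.
  by under eq_fun do rewrite addn2 T.
have sub P : (P <= P ^ k)%N.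
  by case: P => // P; rewrite -{1}[P.+1]expn1 leq_pexp2l.
have c2 := cvg_subseq sub c1.
rewrite -(cvg_lim _ ez)// -(cvg_lim _ c2)//; congr (limn _).
by apply/funext => P; rewrite sum_prime_pow.
Qed.

End PrimePowerDigits.

Theorem theorem1p1 (R : realType) :
  (forall k : nat, (0 < k)%N ->
     {ae @lebesgue_measure R, forall x : R,
        cf_digit_freq (prime_pow_minus1 k) x n @[n --> \oo]
          --> log2 (riemann_zeta (2 * k)%:R)})
  /\
  (log2 (riemann_zeta 2) = log2 (pi ^+ 2 / 6) :> R /\
   {ae @lebesgue_measure R, forall x : R,
      cf_digit_freq [set p%:Z - 1 | p in [set p : nat | prime p]] x n
        @[n --> \oo] --> log2 (pi ^+ 2 / 6)}).
Proof.
split; first by move=> k k0; exact: prime_pow_digit_frequency.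
split; first by rewrite riemann_zeta2.
rewrite -riemann_zeta2.
have := @prime_pow_digit_frequency R 1 isT.
suff -> : prime_pow_minus1 1 = [set p%:Z - 1 | p in [set p : nat | prime p]] by [].
by rewrite /prime_pow_minus1; apply: eq_imagel => p _; rewrite expr1.
Qed.
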